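(* Let $n$ be the number of vertices and $k$ the number of players, and let $\alpha$ satisfy $\alpha=\Omega(\log n)$ and $\alpha=o(\min\{\sqrt{n/k},k\})$. Then the simultaneous communication complexity of $\alpha$-approximating the maximum matching problem in the random partition model is $\Omega(nk/\alpha^2)$ bits.
   Context: Multi-party simultaneous communication model: the input graph $G$ on $n$ vertices is partitioned among $k$ players $P^{(1)},\dots,P^{(k)}$, who share public randomness; each player simultaneously sends one message to a coordinator, who then must output the answer based only on the messages. The communication cost is the total number of bits sent. In the random partition model the edge set of $G$ is partitioned by assigning each edge independently to a player chosen uniformly at random. An $\alpha$-approximation protocol for maximum matching outputs a matching of $G$ of size at least $\mathrm{MM}(G)/\alpha$, where $\mathrm{MM}(G)$ is the maximum matching size (with constant success probability). *)

(* Defs.v *)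
(* MathComp / MathComp-Analysis *)
From HB Require Import structures.
From mathcomp Require Export all_boot all_order all_algebra.
From mathcomp Require Export all_classical all_reals all_analysis.
Export Order.TTheory GRing.Theory Num.Theory numFieldNormedType.Exports.

Set Implicit Arguments.
Unset Strict Implicit.
Unset Printing Implicit Defensive.

Local Open Scope classical_set_scope.
Local Open Scope ring_scope.

(* A graph on the vertex set 'I_n is given by its edge set; matchings have the
   same type. *)
Notation edge_set n := {set {set 'I_n}}.

Definition simple_graph (n : nat) (G : edge_set n) : bool :=
  [forall e in G, #|e| == 2%N].

Definition is_matching (n : nat) (G M : edge_set n) : bool :=
  (M \subset G) && finset.trivIset M.

Definition MM (n : nat) (G : edge_set n) : nat :=
  (\max_(M : edge_set n | is_matching G M) #|M|)%N.

(* An assignment names a player for every vertex set, but only its values on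
   the edges of G matter: under a uniform assignment the edges of G go to
   independent uniform players. *)
Notation assignment n k := {ffun {set 'I_n} -> 'I_k}.

Definition player_edges (n k : nat) (G : edge_set n) (a : assignment n k)
    (i : 'I_k) : edge_set n :=
  [set e in G | a e == i]%SET.

(* T is the space of public coins.  The coins are visible to everybody, so the
   coordinator may use them too, but the input reaches it only through the
   messages.  Messages are bit strings of arbitrary, input-dependent length. *)
Record protocol {d : measure_display} (T : measurableType d) (n k : nat) :=
  Protocol {
    message : 'I_k -> T -> edge_set n -> seq bool ;
    output : T -> {ffun 'I_k -> seq bool} -> edge_set n ;
    measurable_message : forall (i : 'I_k) (E : edge_set n) (m : seq bool),
      measurable [set w | message i w E = m] ;
    measurable_output : forall (t : {ffun 'I_k -> seq bool}) (M : edge_set n),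
      measurable [set w | output w t = M]
  }.

Definition transcript {d : measure_display} (T : measurableType d) (n k : nat)
    (Pi : protocol T n k) (G : edge_set n) (a : assignment n k) (w : T) :
    {ffun 'I_k -> seq bool} :=
  [ffun i => message Pi i w (player_edges G a i)].

Definition run {d : measure_display} (T : measurableType d) (n k : nat)
    (Pi : protocol T n k) (G : edge_set n) (a : assignment n k) (w : T) :
    edge_set n :=
  output Pi w (transcript Pi G a w).

Definition cost (R : realType) {d : measure_display} (T : measurableType d)
    (n k : nat) (Pi : protocol T n k) : \bar R :=
  ereal_sup [set c | exists (G : edge_set n) (a : assignment n k) (w : T),
    simple_graph G /\
    c = ((\sum_(i < k) size (transcript Pi G a w i))%N%:R)%:E].

Definition approx_matching (R : realType) (n : nat) (G M : edge_set n)
    (alpha : R) : Prop :=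
  is_matching G M /\ (MM G)%:R / alpha <= #|M|%:R.

(* Probability over the public coins and the uniform random edge partition. *)
Definition success_prob (R : realType) {d : measure_display}
    (T : measurableType d) (P : probability T R) (n k : nat)
    (Pi : protocol T n k) (alpha : R) (G : edge_set n) : \bar R :=
  ((#|{: assignment n k}|%:R^-1)%:E *
   \sum_(a : assignment n k)
     P [set w | approx_matching G (run Pi G a w) alpha])%E.

Definition approximates (R : realType) {d : measure_display}
    (T : measurableType d) (P : probability T R) (n k : nat)
    (Pi : protocol T n k) (alpha p : R) : Prop :=
  forall G : edge_set n, simple_graph G ->
    (p%:E <= success_prob P Pi alpha G)%E.

(* Simultaneous communication complexity of alpha-approximating the maximum
   matching with success probability p in the random partition model. *)
Definition simultaneous_cc (R : realType) (n k : nat) (alpha p : R) : \bar R :=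
  ereal_inf [set c | exists (d : measure_display) (T : measurableType d)
    (P : probability T R) (Pi : protocol T n k),
    approximates P Pi alpha p /\ c = cost R Pi].

(* Main.v *)
(* Every right vertex is independently either hidden, keeping one random slot,
   or, with probability of order 1 / alpha, a cover vertex keeping d ~ k / 2
   slots; a slot becomes an edge through a random bit that picks one of two left
   endpoints.  The cover vertices cannot make up an alpha-approximate matching,
   so a successful output contains many hidden edges.  A player sees about one
   slot of a cover vertex and cannot distinguish it from a hidden one, so the
   same view of player i is consistent with r ~ k / alpha worlds whose hidden
   edges seen by i are pairwise disjoint.  The message of i, decoded in each of
   these worlds, would have to reveal r times as many random bits as hidden edges
   of i are output, which by a union bound over messages and sets of successful
   worlds bounds the expected number of such edges by about |message| / r.
   Summing over the players gives r * n / alpha = O(total message length). *)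
Require Import Defs.
From mathcomp Require Import measurable_realfun ring lra zify.

Set Implicit Arguments.
Unset Strict Implicit.
Unset Printing Implicit Defensive.

Local Open Scope ring_scope.

(** * Product laws on finite functions *)

Lemma sum_prod_ffun (R : comNzRingType) (I T : finType) (A : I -> T -> R) :
  \sum_(f : {ffun I -> T}) \prod_i A i (f i) = \prod_i \sum_t A i t.
Proof. by rewrite bigA_distr_bigA. Qed.

(** Grouping the [f] by their image factorises over the coordinates. This transports product laws
    along coordinatewise maps: from coloured vertices to worlds, and from slot owners to states. *)
Lemma sum_prod_push (R : comNzRingType) (I T T' : finType) (w : I -> T -> R)
    (phi : I -> T -> T') (F : {ffun I -> T'} -> R) :
  \sum_(f : {ffun I -> T}) (\prod_i w i (f i)) * F [ffun i => phi i (f i)] =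
  \sum_(g : {ffun I -> T'}) (\prod_i \sum_(t | phi i t == g i) w i t) * F g.
Proof.
transitivity (\sum_(g : {ffun I -> T'}) \sum_(f : {ffun I -> T})
   (\prod_i (if phi i (f i) == g i then w i (f i) else 0)) * F g); last first.
  apply: eq_bigr => g _; rewrite -big_distrl /=; congr (_ * _).
  rewrite (sum_prod_ffun (fun i t => if phi i t == g i then w i t else 0)).
  by apply: eq_bigr => i _; rewrite -big_mkcond.
rewrite exchange_big /=; apply: eq_bigr => f _.
rewrite (bigD1 [ffun i => phi i (f i)]) //= [X in _ + X]big1 ?addr0 => [|g gf].
  by congr (_ * _); apply: eq_bigr => i _; rewrite ffunE eqxx.
have [i gi] : exists i, phi i (f i) != g i.
  apply/existsP; rewrite -[X in is_true X]negbK negb_exists.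
  apply: contra gf => /forallP h; apply/eqP/ffunP => i; rewrite ffunE.
  by have := h i; rewrite negbK => /eqP.
by rewrite (bigD1 i) //= (negPf gi) !mul0r.
Qed.

(** Coordinates of an i.i.d. family read at distinct places are i.i.d. again. It reduces an
    assignment of all vertex sets to the potential edges picked by the bits. *)
Lemma sum_prod_restrict (R : comNzRingType) (I E T : finType) (w : T -> R)
    (phi : I -> E) (F : {ffun I -> T} -> R) :
  \sum_t w t = 1 -> injective phi ->
  \sum_(a : {ffun E -> T}) (\prod_e w (a e)) * F [ffun i => a (phi i)] =
  \sum_(b : {ffun I -> T}) (\prod_i w (b i)) * F b.
Proof.
move=> w1 phiI.
(* At [phi i] this forces the value [b i]; off the image of [phi] it is void, so those factors sum
   to 1. *)
pose ok (b : {ffun I -> T}) e t := [forall i, (phi i == e) ==> (t == b i)].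
transitivity (\sum_(b : {ffun I -> T}) \sum_(a : {ffun E -> T})
   (\prod_e (if ok b e (a e) then w (a e) else 0)) * F b); last first.
  apply: eq_bigr => b _; rewrite -big_distrl /=; congr (_ * _).
  rewrite (sum_prod_ffun (fun e t => if ok b e t then w t else 0)).
  rewrite (bigID (mem (phi @: [set: I])))%SET /= [X in _ * X]big1 ?mulr1.
    rewrite big_imset /=; last by move=> ? ? _ _; apply: phiI.
    apply: eq_big => [i|i _]; first by rewrite inE.
    rewrite -big_mkcond (big_pred1 (b i)) // => t; apply/forallP/eqP => [/(_ i)|-> j].
      by rewrite eqxx => /eqP.
    by apply/implyP => /eqP /phiI ->.
  move=> e eN; rewrite -big_mkcond -[RHS]w1; apply: eq_bigl => t.
  apply/forallP => i; apply/implyP => /eqP ie.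
  by rewrite -ie imset_f ?inE in eN.
rewrite exchange_big /=; apply: eq_bigr => a _.
rewrite (bigD1 [ffun i => a (phi i)]) //= [X in _ + X]big1 ?addr0 => [|g gf].
  congr (_ * _); apply: eq_bigr => e _; rewrite ifT //.
  by apply/forallP => i; apply/implyP => /eqP <-; rewrite ffunE.
have [i gi] : exists i, a (phi i) != g i.
  apply/existsP; rewrite -[X in is_true X]negbK negb_exists.
  apply: contra gf => /forallP h; apply/eqP/ffunP => i; rewrite ffunE.
  by have := h i; rewrite negbK => /eqP.
rewrite (bigD1 (phi i)) //= ifF ?mul0r //.
by apply/negP => /forallP/(_ i); rewrite eqxx (negPf gi).
Qed.

(* Exponential form of the fact that a string fixing g bits of x has density 2^-|g|. *)
Lemma sum_pow_fixed_bits (I : finType) (O : {set I})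
    (g : {ffun I -> bool} -> {set I * bool}) :
  (forall x y : {ffun I -> bool}, (forall i, i \notin O -> x i = y i) -> g x = g y) ->
  (forall x z, z \in g x -> z.1 \in O) ->
  (\sum_(x : {ffun I -> bool} | [forall z in g x, x z.1 == z.2]) 2 ^ #|g x|
     <= 2 ^ #|I|)%N.
Proof.
move=> gout gO.
pose ok (x : {ffun I -> bool}) := [forall z in g x, x z.1 == z.2].
pose S (x : {ffun I -> bool}) := [set z.1 | z in g x]%SET.
(* Flipping any of the guessed bits of x is injective: it leaves g x unchanged. *)
pose flip (x : {ffun I -> bool}) (A : {set I}) := [ffun i => x i (+) (i \in A)].
have gflip x (A : {set I}) : A \subset S x -> g (flip x A) = g x.
  move=> AS; apply: gout => i iO; rewrite ffunE.
  suff -> : i \in A = false by rewrite addbF.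
  apply/negP => /(fintype.subsetP AS)/imsetP[z zg iz].
  by move: iO; rewrite iz (gO x).
(* The sum counts pairs of a correct [x] and a subset of its guessed positions: a correct guess
   never names a position twice, so [S x] is as large as [g x]. *)
pose P := [set z : {ffun I -> bool} * {set I} | ok z.1 && (z.2 \subset S z.1)]%SET.
have -> : (\sum_(x | ok x) 2 ^ #|g x| = #|P|)%N.
  rewrite -[RHS]sum1_card (eq_bigl (fun z : {ffun I -> bool} * {set I} =>
    ok z.1 && (z.2 \subset S z.1))); last first.
    by move=> z; rewrite inE.
  rewrite -(pair_big_dep ok (fun x (A : {set I}) => A \subset S x) (fun _ _ => 1%N)) /=.
  apply: eq_bigr => x okx; rewrite sum1dep_card.
  have <- : #|S x| = #|g x|.
    apply: card_in_imset => -[i a] [j b] ia jb /= ij; rewrite ij in ia *.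
    move/forallP: okx => okx; have := okx (j, a); have := okx (j, b).
    by rewrite ia jb => /eqP /= <- /eqP <-.
  by rewrite -card_powerset; apply: eq_card => A; rewrite !inE.
have <- : #|{ffun I -> bool}| = (2 ^ #|I|)%N by rewrite card_ffun card_bool.
rewrite -cardsT.
rewrite -(card_in_imset (f := fun z => flip z.1 z.2) (D := P)).
  by apply: subset_leq_card; apply: finset.subsetT.
move=> [x A] [y B]; rewrite !inE /= => /andP[okx Ax] /andP[oky By] e.
have gxy : g x = g y by rewrite -(gflip x A Ax) e gflip.
have xy i : i \in S x -> x i = y i.
  case/imsetP => -[j c] jc -> /=.
  move/forallP: okx => /(_ (j, c)); rewrite jc => /eqP /= ->.
  by move/forallP: oky => /(_ (j, c)); rewrite -gxy jc => /eqP /= ->.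
have exy i := congr1 (fun f : {ffun I -> bool} => f i) e.
have {}exy i : x i (+) (i \in A) = y i (+) (i \in B) by have := exy i; rewrite !ffunE.
have AB : A = B.
  apply/setP => i; have := exy i.
  have [iS|iS] := boolP (i \in S x); first by rewrite xy // => /addbI.
  have -> : i \in A = false by apply: contraNF iS => /(fintype.subsetP Ax).
  suff -> : i \in B = false by [].
  by apply: contraNF iS => /(fintype.subsetP By); rewrite /S gxy.
by congr (_, _) => //; apply/ffunP => i; have := exy i; rewrite AB => /addIb.
Qed.

(** * Guessing random bits from a message *)

Lemma count_size_uniq (s : seq (seq bool)) (l : nat) :
  uniq s -> (count (fun t => size t == l) s <= 2 ^ l)%N.
Proof.
move=> us; rewrite -size_filter; set s' := seq.filter _ s.
have us' : uniq s' by apply: filter_uniq.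
pose u : seq (l.-tuple bool) := pmap insub s'.
have -> : size s' = size u.
  by rewrite size_pmap_sub; apply/esym/eqP; rewrite -all_count; apply: filter_all.
have uu : uniq u by apply: pmap_sub_uniq.
rewrite -(card_uniqP uu); apply: leq_trans (max_card _) _.
by rewrite card_tuple card_bool.
Qed.

(** At most [2 ^ l] distinct strings have length [l], so base 4 leaves a geometric series of ratio
    1/2, without any prefix-freeness of the strings. *)
Lemma sum_quarter_pow_size (R : realFieldType) (s : seq (seq bool)) :
  uniq s -> \sum_(t <- s) (4^-1 : R) ^+ size t <= 2.
Proof.
move=> us.
pose L := \max_(t <- s) size t.
have Ls t : t \in s -> (size t < L.+1)%N.
  by move=> ts; rewrite ltnS /L (bigD1_seq t) //= leq_maxl.
have -> : \sum_(t <- s) (4^-1 : R) ^+ size t =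
    \sum_(l < L.+1) \sum_(t <- s | size t == l) (4^-1 : R) ^+ l.
  rewrite (exchange_big_dep xpredT) //= big_seq [RHS]big_seq; apply: eq_bigr => t ts.
  by rewrite (big_pred1 (Ordinal (Ls t ts))) // => i; rewrite /= -val_eqE /= eq_sym.
have half n : \sum_(l < n) (2^-1 : R) ^+ l = 2 - 2 * 2^-1 ^+ n.
  elim: n => [|n IH]; first by rewrite big_ord0 expr0; ring.
  by rewrite big_ord_recr /= IH exprS; field.
apply: (@le_trans _ _ (\sum_(l < L.+1) (2^-1 : R) ^+ l)); last first.
  by rewrite half gerBl mulr_ge0 // exprn_ge0 // invr_ge0.
apply: ler_sum => l _; rewrite big_const_seq iter_addr_0.
have -> : (4^-1 : R) = 2^-1 * 2^-1 by field.
rewrite exprMn -mulrnAr -[_ *+ count _ _]mulr_natr ler_piMr ?exprn_ge0 ?invr_ge0 //.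
rewrite exprVn mulrC ler_pdivrMr ?exprn_gt0 // mul1r -natrX ler_nat.
exact: count_size_uniq.
Qed.

(* Union bound over the set J of correct guesses and over the messages, the
   latter weighted by 4^-size, for a total weight of at most 2. *)
Lemma sum_correct_guesses (I : finType) (O : {set I}) (r : nat)
    (m : {ffun I -> bool} -> seq bool)
    (g : 'I_r -> seq bool -> {ffun I -> bool} -> {set I * bool}) :
  (forall j t (x y : {ffun I -> bool}),
     (forall i, i \notin O -> x i = y i) -> g j t x = g j t y) ->
  (forall j t x z, z \in g j t x -> z.1 \in O) ->
  (forall j j' t x z z', z \in g j t x -> z' \in g j' t x -> z.1 = z'.1 -> j = j') ->
  (\sum_(x : {ffun I -> bool}) \sum_(j < r | [forall z in g j (m x) x, x z.1 == z.2])
      #|g j (m x) x| <= \sum_(x : {ffun I -> bool}) (2 * size (m x) + r + 2))%N.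
Proof.
move=> gout gO gdisj.
pose ok (x : {ffun I -> bool}) (A : {set I * bool}) := [forall z in A, x z.1 == z.2].
pose U (J : {set 'I_r}) t x := (\bigcup_(j in J) g j t x)%SET.
pose Jx x := [set j | ok x (g j (m x) x)]%SET.
pose Y x := (\sum_(j < r | ok x (g j (m x) x)) #|g j (m x) x|)%N.
(* Distinct [j] guess at disjoint positions, so the sizes add up inside the union. *)
have YU x : (Y x <= #|U (Jx x) (m x) x|)%N.
  pose P := [set p : 'I_r * (I * bool) |
    ok x (g p.1 (m x) x) && (p.2 \in g p.1 (m x) x)]%SET.
  have -> : Y x = #|P|.
    rewrite -[RHS]sum1_card (eq_bigl (fun p : 'I_r * (I * bool) =>
      ok x (g p.1 (m x) x) && (p.2 \in g p.1 (m x) x))); last by move=> p; rewrite inE.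
    rewrite -(pair_big_dep (fun j => ok x (g j (m x) x))
      (fun j z => z \in g j (m x) x) (fun _ _ => 1%N)) /=.
    by apply: eq_bigr => j _; rewrite sum1_card.
  rewrite -(card_in_imset (f := snd) (D := P)).
    apply/subset_leq_card/fintype.subsetP => z /imsetP[[j z']].
    rewrite inE /= => /andP[okj zj] ->; apply/bigcupP; exists j => //.
    by rewrite inE.
  move=> [j z] [j' z']; rewrite !inE /= => /andP[_ zj] /andP[_ zj'] zz.
  by rewrite -zz in zj' *; rewrite (gdisj j j' _ _ _ _ zj zj').
have okU x : ok x (U (Jx x) (m x) x).
  apply/forallP => z; apply/implyP => /bigcupP[j]; rewrite inE => /forallP/(_ z) h zg.
  by rewrite zg in h.
(* With [J] and [t] frozen the guess depends only on bits outside [O]; with the true message [m x]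
   it may depend on all bits. *)
have UB J t : (\sum_(x | ok x (U J t x)) 2 ^ #|U J t x| <= 2 ^ #|I|)%N.
  apply: (sum_pow_fixed_bits (O := O)) => [x y xy|x z /bigcupP[j _]]; last exact: gO.
  by apply: eq_bigr => j _; apply: gout.
(* An excess [e] over [2 * size (m x) + r] is below [2 ^ e]; the exponential form supplies the
   weights needed for the union bound. *)
have lin x : ((Y x)%:R : rat) <= (2 * size (m x) + r)%:R +
    2 ^+ #|U (Jx x) (m x) x| * (4^-1 ^+ size (m x) * 2^-1 ^+ r).
  have -> : (4^-1 : rat) ^+ size (m x) * 2^-1 ^+ r = (2 ^+ (2 * size (m x) + r))^-1.
    by rewrite exprD exprM invfM -!exprVn.
  have [le|/ltnW lt] := leqP (Y x) (2 * size (m x) + r).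
    by apply: ler_wpDr; rewrite ?ler_nat // divr_ge0 // exprn_ge0.
  rewrite -lerBlDl -natrB // ler_pdivlMr ?exprn_gt0 // -natrX -natrM -natrX ler_nat.
  apply: leq_trans (leq_mul (ltnW (ltn_expl _ (ltnSn 1))) (leqnn _)) _.
  by rewrite -expnD subnK // leq_exp2l.
pose s := undup [seq m x | x <- enum {ffun I -> bool}].
have ms x : m x \in s by rewrite mem_undup map_f // mem_enum.
pose T t J x : rat := (if ok x (U J t x) then 2 ^+ #|U J t x| else 0) *
   (4^-1 ^+ size t * 2^-1 ^+ r).
have T0 t J x : 0 <= T t J x.
  by rewrite /T mulr_ge0 ?mulr_ge0 ?exprn_ge0 ?invr_ge0 //; case: ifP => // _; rewrite exprn_ge0.
(* The true pair [(m x, Jx x)] is one of all pairs [(t, J)]. Each pair contributes at most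
   [2 ^ #|I|] times its weight; the [2 ^ r] sets [J] cancel [2^-1 ^+ r] and the messages add up to
   at most 2. *)
have bnd : \sum_(x : {ffun I -> bool}) T (m x) (Jx x) x <=
    \sum_(x : {ffun I -> bool}) 2.
  apply: (@le_trans _ _ (\sum_(x : {ffun I -> bool}) \sum_(t <- s) \sum_J T t J x)).
    apply: ler_sum => x _; rewrite (bigD1_seq (m x)) ?undup_uniq //= (bigD1 (Jx x)) //=.
    by rewrite -addrA lerDl addr_ge0 ?sumr_ge0 // => t _; rewrite sumr_ge0.
  rewrite exchange_big /=.
  apply: (@le_trans _ _ (\sum_(t <- s) (4^-1 ^+ size t) * (2 ^+ #|I|))).
    apply: ler_sum => t _; rewrite exchange_big /=.
    apply: (@le_trans _ _ (\sum_(J : {set 'I_r}) (4^-1 ^+ size t * 2^-1 ^+ r) * 2 ^+ #|I|)).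
      apply: ler_sum => J _; rewrite -big_distrl /= mulrC ler_wpM2l ?mulr_ge0 ?exprn_ge0 ?invr_ge0 //.
      rewrite -big_mkcond /=; under eq_bigr do rewrite -natrX.
      by rewrite -natr_sum -natrX ler_nat.
    rewrite sumr_const (_ : #|{set _}| = 2 ^ r)%N; last first.
      by rewrite -cardsT -powersetT card_powerset cardsT card_ord.
    rewrite -[_ *+ _]mulr_natr natrX.
    have : (2^-1 : rat) ^+ r * 2 ^+ r = 1 by rewrite -exprMn mulVf // expr1n.
    by move=> h; rewrite mulrAC -(mulrA (4^-1 ^+ _)) h mulr1.
  rewrite -mulr_suml sumr_const card_ffun card_bool -[_ *+ (_ ^ _)]mulr_natr natrX.
  by rewrite ler_wpM2r ?exprn_ge0 // sum_quarter_pow_size // undup_uniq.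
rewrite -(ler_nat rat) !natr_sum.
apply: (@le_trans _ _ (\sum_(x : {ffun I -> bool}) ((2 * size (m x) + r)%:R + T (m x) (Jx x) x))).
  by apply: ler_sum => x _; rewrite /T okU; apply: lin.
rewrite big_split /=; under [leRHS]eq_bigr do rewrite natrD.
by rewrite [leRHS]big_split /= lerD2l.
Qed.

(** * The hard graph *)

(* Right vertices [(b, u)] and slots: [((b, u), l)] is the pair of potential
   edges from [(b, u)] to the left vertices [(b, l, false)] and [(b, l, true)]. *)
Local Notation right B D := ('I_B * 'I_D)%type.
Local Notation slot B D d := ('I_B * 'I_D * 'I_d)%type.
Local Notation vertex B D d := (right B D + 'I_B * 'I_d * bool)%type.

(* The state of a right vertex: hidden, with its only slot and the player who
   receives it, or cover, with the owner of each of its d slots. *)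
Local Notation state d k := ('I_d * 'I_k + {ffun 'I_d -> 'I_k})%type.

Section HardGraph.
Variables (n k d D B : nat) (iota : vertex B D d -> 'I_n).
Hypothesis iotaI : injective iota.
Implicit Types (v u : right B D) (s : slot B D d) (y : bool) (t : state d k)
  (st : {ffun right B D -> state d k}) (x : {ffun slot B D d -> bool}).

Definition edge s y : {set 'I_n} :=
  [set iota (inl s.1); iota (inr (s.1.1, s.2, y))]%SET.

Definition active t (l : 'I_d) := if t is inl (l0, _) then l == l0 else true.

Definition owner t (l : 'I_d) : 'I_k :=
  match t with inl (_, i) => i | inr b => b l end.

Definition hidden_slot t : option 'I_d := if t is inl (l, _) then Some l else None.

Definition graph st x : edge_set n :=
  [set edge s (x s) | s : slot B D d & active (st s.1) s.2]%SET.

Definition sees st (i : 'I_k) s := active (st s.1) s.2 && (owner (st s.1) s.2 == i).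

Definition share st x (i : 'I_k) : edge_set n :=
  [set edge s (x s) | s : slot B D d & sees st i s]%SET.

Definition found t x (M : edge_set n) v (i : 'I_k) : bool :=
  if t is inl (l, i') then (i' == i) && (edge (v, l) (x (v, l)) \in M) else false.

Definition hits st x M i : nat := #|[set v | found (st v) x M v i]%SET|.

Definition covers st : nat := #|[set v | hidden_slot (st v) == None]%SET|.

(** Ordered pairs of hidden vertices in one block with the same slot index: only these can make two
    hidden edges share a left endpoint. *)
Definition collisions st : nat :=
  (\sum_v \sum_(u | (u != v) && (u.1 == v.1)) \sum_l
     (hidden_slot (st u) == Some l) * (hidden_slot (st v) == Some l))%N.

Lemma mem_edge_right s y v : (iota (inl v) \in edge s y) = (s.1 == v).
Proof.
by rewrite !inE !(inj_eq iotaI) orbF eq_sym.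
Qed.

Lemma mem_edge_left s y c : (iota (inr c) \in edge s y) = ((s.1.1, s.2, y) == c).
Proof. by rewrite !inE !(inj_eq iotaI) /= eq_sym. Qed.

Lemma edge_inj s y s' y' : edge s y = edge s' y' -> s = s' /\ y = y'.
Proof.
move=> e.
have /eqP e1 : s'.1 == s.1 by rewrite -(mem_edge_right s' y') -e mem_edge_right.
have : (s'.1.1, s'.2, y') == (s.1.1, s.2, y).
  by rewrite -(mem_edge_left s' y') -e mem_edge_left.
by case: s s' e1 {e} => [v l] [v' l'] /= -> /eqP[-> ->].
Qed.

Lemma card_edge s y : #|edge s y| = 2%N.
Proof. by rewrite cards2 (inj_eq iotaI). Qed.

Lemma graph_simple st x : simple_graph (graph st x).
Proof.
apply/forallP => e; apply/implyP => /imsetP[s _ ->]; by rewrite card_edge.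
Qed.

Lemma mem_graph st x s y :
  edge s y \in graph st x -> active (st s.1) s.2 /\ y = x s.
Proof. by case/imsetP => s'; rewrite inE => a /edge_inj[-> ->]. Qed.

(** Matching edges have distinct right endpoints, and each of these is a cover vertex or a hidden
    vertex found for the owner of its slot. *)
Lemma card_matching_le st x M :
  is_matching (graph st x) M ->
  (#|M| <= covers st + \sum_i hits st x M i)%N.
Proof.
case/andP => MG /finset.trivIsetP tM.
pose S := [set s | edge s (x s) \in M]%SET.
have -> : #|M| = #|[set edge s (x s) | s in S]%SET|.
  congr #|pred_of_set _|; apply/setP => e; apply/idP/imsetP => [eM|[s]]; last by rewrite inE => h ->.
  have /imsetP[s _ es] := fintype.subsetP MG e eM.
  by exists s => //; rewrite inE -es.
rewrite card_in_imset; last by move=> s s' _ _ /edge_inj[].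
rewrite -(card_in_imset (f := fst) (D := S)); last first.
  move=> s s'; rewrite !inE => sM sM' ss.
  case: (eqVneq (edge s (x s)) (edge s' (x s'))) => [/edge_inj[] //|ne].
  have /disjointFr := tM _ _ sM sM' ne.
  move=> /(_ (iota (inl s.1))); rewrite mem_edge_right eqxx => /(_ erefl).
  by rewrite mem_edge_right ss eqxx.
pose H i := [set v | found (st v) x M v i]%SET.
apply: (@leq_trans #|([set v | hidden_slot (st v) == None] :|: \bigcup_i H i)%SET|).
  apply/subset_leq_card/fintype.subsetP => v /imsetP[[v' l]]; rewrite !inE => sM -> /=.
  have [/= a _] := mem_graph (fintype.subsetP MG _ sM).
  case E : (st v') a => [[l0 i]|b] //= /eqP ll.
  by apply/bigcupP; exists i => //; rewrite inE /found E eqxx -ll.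
apply: leq_trans (leq_card_setU _ _) _; rewrite leq_add2l.
elim/big_rec2: _ => [|i a A _ h]; first by rewrite cards0.
exact: leq_trans (leq_card_setU _ _) (leq_add (leqnn _) h).
Qed.

(** The hidden edges at vertices without a collision (the set [Gd]) are pairwise disjoint, hence
    form a matching. *)
Lemma MM_graph_ge st x :
  (#|{: right B D}| <= MM (graph st x) + covers st + collisions st)%N.
Proof.
pose meets u v := [&& u != v, u.1 == v.1 & hidden_slot (st u) == hidden_slot (st v)].
pose C := [set v | hidden_slot (st v) == None]%SET.
pose Bad := [set v | (v \notin C) && [exists u, meets u v]]%SET.
pose Gd := [set v | (v \notin C) && ~~ [exists u, meets u v]]%SET.
have badcoll : (#|Bad| <= collisions st)%N.
  rewrite -sum1_card big_mkcond /=; apply: leq_sum => v _; case: ifP => //.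
  rewrite !inE => /andP[vC /existsP[u /and3P[uv bl /eqP hs]]].
  rewrite (bigD1 u) /= ?uv //.
  case E : (hidden_slot (st v)) vC => [l|] // _.
  by rewrite (bigD1 l) //= hs E eqxx.
have cards : (#|{: right B D}| <= #|Gd| + #|C| + #|Bad|)%N.
  rewrite -cardsT; apply: (@leq_trans #|(Gd :|: C :|: Bad)%SET|).
    apply/subset_leq_card/fintype.subsetP => v _; rewrite !inE.
    by case: eqP => //= _; rewrite ?orbT //; case: [exists u, _].
  apply: leq_trans (leq_card_setU _ _) _; rewrite leq_add2r; exact: leq_card_setU.
suff GM : (#|Gd| <= MM (graph st x))%N by rewrite (leq_trans cards) // leq_add // leq_add2r.
pose S := [set s : slot B D d | (s.1 \in Gd) && (hidden_slot (st s.1) == Some s.2)]%SET.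
pose M0 := [set edge s (x s) | s in S]%SET.
have GS : (#|Gd| <= #|M0|)%N.
  rewrite [#|M0|]card_in_imset; last by move=> s s' _ _ /edge_inj[].
  apply: leq_trans (leq_imset_card fst S).
  apply/subset_leq_card/fintype.subsetP => v vG; apply/imsetP.
  have := vG; rewrite !inE => /andP[]; case E : (hidden_slot (st v)) => [l|] // _ _.
  by exists (v, l) => //; rewrite inE vG /= E.
apply: leq_trans GS _; rewrite /MM.
have M0m : is_matching (graph st x) M0.
  apply/andP; split.
    apply/fintype.subsetP => e /imsetP[s]; rewrite inE => /andP[_ /eqP hs] ->.
    apply/imsetP; exists s => //; rewrite inE.
    by move: hs; rewrite /active; case: (st s.1) => [[l0 i]|] //= [->].
  apply/finset.trivIsetP => e e' /imsetP[s sS ->] /imsetP[s' sS' ->] ne.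
  rewrite finset.disjoints_subset; apply/fintype.subsetP => a ae.
  rewrite finset.in_setC; apply/negP => ae'; move/negP: ne; apply; apply/eqP.
  suff -> : s = s' by [].
  move: sS sS'; rewrite !inE => /andP[/andP[_ nm] /eqP hs] /andP[/andP[_ nm'] /eqP hs'].
  have key : s.1 = s'.1 -> s = s'.
    move: hs hs' {nm nm' ae ae'}; case: s s' => [v l] [v' l'] /= hs hs' e1.
    by move: hs'; rewrite -e1 hs => -[<-].
  move: ae; rewrite !inE => /orP[/eqP ea|/eqP ea]; subst a.
    by move: ae'; rewrite mem_edge_right => /eqP/esym/key.
  move: ae'; rewrite mem_edge_left => /eqP[e1 e2 _].
  apply: key; apply/eqP; apply: contraNT nm => ne; apply/existsP; exists s'.1.
  by rewrite /meets eq_sym ne e1 eqxx hs hs' e2 eqxx.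
exact: (@leq_bigmax_cond _ (fun M => is_matching (graph st x) M) (fun M => #|M|) M0).
Qed.
End HardGraph.

(** * Coupling of worlds seen alike by one player *)

Section Coupling.
Variables (R : realFieldType) (n k d D B : nat) (iota : vertex B D d -> 'I_n).
Hypothesis iotaI : injective iota.
Variables (mu : R) (msg : 'I_k -> edge_set n -> seq bool)
  (out : {ffun 'I_k -> seq bool} -> edge_set n).
Implicit Types (v u : right B D) (s : slot B D d) (y : bool) (t : state d k)
  (st : {ffun right B D -> state d k}) (x : {ffun slot B D d -> bool}).

(** Law of one right vertex: cover with probability [mu], hidden otherwise, and uniform within each
    kind. *)
Definition weight t : R :=
  if t is inl _ then (1 - mu) / (d%:R * k%:R) else mu / k%:R ^+ d.

Definition outcome st x : edge_set n :=
  out [ffun i => msg i (share iota st x i)].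

(** An output with a false edge gains nothing, so whatever is gained consists of correctly guessed
    bits. *)
Definition gain st x i : nat :=
  if outcome st x \subset graph iota st x then hits iota st x (outcome st x) i else 0.

Section Player.
Variables (r : nat) (i : 'I_k).
Implicit Types (b : {ffun 'I_d -> 'I_k}) (c : option 'I_r).

Definition single b : option 'I_d :=
  [pick l | [forall l', (b l' == i) == (l' == l)]].

(** A vertex before a world is chosen: hidden in all worlds, or a full slot assignment with a
    colour, namely the world, if any, that may turn it hidden. *)
Definition world_state : finType :=
  ('I_d * 'I_k + {ffun 'I_d -> 'I_k} * option 'I_r)%type.

(* World j turns the cover vertices coloured j that show player i a single slot
   into hidden ones; player i cannot tell. *)
Definition world (j : 'I_r) (o : world_state) : state d k :=
  match o with
  | inl z => inl z
  | inr (b, c) => if c == Some j then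
      (if single b is Some l then inl (l, i) else inr b) else inr b
  end.

(* The mass of the hidden state (l, i) is split evenly among the (k-1)^(d-1)
   assignments that show player i the slot l only. *)
Definition eps : R := (1 - mu) / (d%:R * k%:R) / k.-1%:R ^+ d.-1.

(** Player [i] gets no hidden state directly, so in each world its hidden edges come from coloured
    vertices. Colourless vertices showing [i] a single slot give up the mass of only [r - 1]
    colours, because one colour is turned hidden. *)
Definition world_weight (o : world_state) : R :=
  match o with
  | inl (_, i') => if i' == i then 0 else (1 - mu) / (d%:R * k%:R)
  | inr (b, None) => if single b then mu / k%:R ^+ d - r%:R * eps + eps
                     else mu / k%:R ^+ d
  | inr (b, Some _) => if single b then eps else 0
  end.

Definition shown (o : world_state) (l : 'I_d) : bool :=
  match o with
  | inl (l0, i0) => (l == l0) && (i0 == i)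
  | inr (b, _) => b l == i
  end.

Lemma single_spec b l : (single b == Some l) = [forall l', (b l' == i) == (l' == l)].
Proof.
rewrite /single; case: pickP => [l0 h0|h]; last by rewrite h.
apply/eqP/idP => [[<-] //|hl]; congr Some; apply/eqP.
have /forallP/(_ l0)/eqP := hl; have /forallP/(_ l0)/eqP -> := h0.
by rewrite eqxx => /esym.
Qed.

Lemma card_single l : (0 < k)%N -> #|[set b | single b == Some l]| = (k.-1 ^ d.-1)%N.
Proof.
move=> k0.
have -> : #|[set b | single b == Some l]%SET| =
    (\sum_(b : {ffun 'I_d -> 'I_k}) \prod_l' ((b l' == i) == (l' == l)))%N.
  rewrite -sum1_card big_mkcond; apply: eq_bigr => b _; rewrite inE single_spec.
  case: ifP => [/forallP h|/negbT]; first by rewrite big1 // => l' _; rewrite h.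
  by rewrite negb_forall => /existsP[l' /negPf h]; rewrite (bigD1 l') //= h.
rewrite -(bigA_distr_bigA (fun l' a => nat_of_bool ((a == i) == (l' == l)))).
rewrite (bigD1 l) //= [X in (X * _)%N](_ : _ = 1)%N; last first.
  rewrite (bigD1 i) //= !eqxx big1 // => a /negPf -> //.
rewrite mul1n (eq_bigr (fun _ => k.-1)).
  by rewrite prod_nat_const cardC1 card_ord.
move=> l' /negPf ll; rewrite (bigD1 i) //= eqxx ll add0n.
rewrite (eq_bigr (fun _ => 1%N)); first by rewrite sum1_card cardC1 card_ord.
by move=> a /negPf ->.
Qed.

Lemma sum_option (f : option 'I_r -> R) : \sum_c f c = f None + \sum_j f (Some j).
Proof.
rewrite (bigD1 None) //=; congr (_ + _).
rewrite (reindex_omap Some id) /=; last by case.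
by apply: eq_bigl => j; rewrite eqxx.
Qed.

(** Colour [j] supplies the missing hidden states of player [i], while the other colours stay cover
    and restore the mass taken from the colourless ones. So every single world has the true law. *)
Lemma world_push j t : (1 < k)%N -> (0 < d)%N ->
  \sum_(o | world j o == t) world_weight o = weight t.
Proof.
move=> k1 d0.
have k10 : (k.-1%:R : R) ^+ d.-1 != 0.
  by rewrite expf_neq0 // pnatr_eq0 -lt0n -subn1 subn_gt0.
rewrite big_mkcond big_sumType /=.
have -> : \sum_(p : {ffun 'I_d -> 'I_k} * option 'I_r)
      (if world j (inr p) == t then world_weight (inr p) else 0) =
    \sum_b \sum_c (if world j (inr (b, c)) == t then world_weight (inr (b, c)) else 0).
  by rewrite pair_bigA; apply: eq_bigr => -[b c].
case: t => [[l0 i0]|b0].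
  rewrite (bigD1 (l0, i0)) //= eqxx [X in _ + X + _]big1 ?addr0; last first.
    move=> z /negPf zz; have -> : ((inl z : state d k) == inl (l0, i0)) = (z == (l0, i0)) by [].
    by rewrite zz.
  have -> : \sum_b \sum_c (if world j (inr (b, c)) == inl (l0, i0) :> state d k
        then world_weight (inr (b, c)) else 0) =
      \sum_(b | single b == Some l0) (if i0 == i then eps else 0).
    rewrite [RHS]big_mkcond; apply: eq_bigr => b _.
    rewrite sum_option /= add0r (bigD1 j) //= eqxx big1 ?addr0; last first.
      by move=> j' /negPf jj; rewrite (_ : (Some j' == Some j) = (j' == j)) // jj.
    case: (single b) => [l|] //=.
    have -> : ((inl (l, i) : state d k) == inl (l0, i0)) = (Some l == Some l0) && (i0 == i).
      by rewrite [i0 == i]eq_sym.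
    by case: (Some l == Some l0) => //=.
  rewrite sumr_const -cardsE card_single; last exact: ltnW.
  case: (eqVneq i0 i) => [_|_]; last by rewrite mul0rn addr0.
  by rewrite add0r -[eps *+ _]mulr_natr natrX /eps divfK.
rewrite [X in X + _]big1 // add0r (bigD1 b0) //= [X in _ + X]big1 ?addr0; last first.
  move=> b /negPf bb; apply: big1 => c _.
  have bb' : ((inr b : state d k) == inr b0) = false by exact: bb.
  case: (c == Some j); last by rewrite bb'.
  by case: (single b) => [l|] /=; rewrite ?bb'.
rewrite sum_option /=.
have -> : ((inr b0 : state d k) == inr b0) by exact: eqxx.
case E : (single b0) => [l|] /=; last first.
  by rewrite big1 ?addr0 // => j' _; rewrite !if_same.
rewrite (bigD1 j) //= eqxx /= add0r (eq_bigr (fun _ => eps)).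
  rewrite sumr_const cardC1 card_ord -[eps *+ _]mulr_natr.
  have -> : (r.-1%:R : R) = r%:R - 1 by rewrite -[in RHS](ltn_predK (ltn_ord j)) -natr1 addrK.
  by ring.
by move=> j' /negPf jj; rewrite (_ : (Some j' == Some j) = (j' == j)) // jj eqxx.
Qed.

(** A vertex turned hidden keeps the only slot that player [i] saw at it; this makes the worlds
    indistinguishable to [i]. *)
Lemma shown_world j o l :
  active (world j o) l && (owner (world j o) l == i) = shown o l.
Proof.
case: o => [[l0 i0] //|[b c]] /=; case: ifP => // _.
case E : (single b) => [l0|] //=.
have /eqP := E; rewrite single_spec => /forallP/(_ l)/eqP ->.
by rewrite eqxx andbT.
Qed.

Definition worlds j (o : {ffun right B D -> world_state}) : {ffun right B D -> state d k} :=
  [ffun v => world j (o v)].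

Definition shown_share (o : {ffun right B D -> world_state}) x : edge_set n :=
  [set edge iota s (x s) | s : slot B D d & shown (o s.1) s.2]%SET.

Lemma share_worlds j o x : share iota (worlds j o) x i = shown_share o x.
Proof.
rewrite /share /shown_share; have -> // : [set s | sees (worlds j o) i s]%SET =
  [set s : slot B D d | shown (o s.1) s.2]%SET.
by apply/setP => s; rewrite !inE /sees ffunE shown_world.
Qed.

(** An instance of [sum_correct_guesses]: the unknown bits [O] are those shown to player [i], and
    world [j] guesses those on the output edges at vertices of colour [j]. Different colours give
    disjoint guesses. *)
Lemma sum_gain_worlds (o : {ffun right B D -> world_state}) :
  (forall v l, o v != inl (l, i)) ->
  (\sum_x \sum_(j < r) gain (worlds j o) x i <=
     \sum_x (2 * size (msg i (shown_share o x)) + r + 2))%N.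
Proof.
move=> oN.
pose O := [set s : slot B D d | shown (o s.1) s.2]%SET.
(* The output in world [j] when the message of player [i] is replaced by an arbitrary string
   [tr]. *)
pose Mx j (tr : seq bool) x := out [ffun i' => if i' == i then tr else msg i' (share iota (worlds j o) x i')].
pose coloured j v := if o v is inr (_, Some j') then j' == j else false.
pose g j (tr : seq bool) x := [set z : slot B D d * bool |
  [&& z.1 \in O, coloured j z.1.1 & edge iota z.1 z.2 \in Mx j tr x]]%SET.
have outE j x : outcome (worlds j o) x = Mx j (msg i (shown_share o x)) x.
  congr out; apply/ffunP => i'; rewrite !ffunE.
  by case: eqP => // ->; rewrite share_worlds.
have gout j tr x x' : (forall s, s \notin O -> x s = x' s) -> g j tr x = g j tr x'.
  move=> xx; suff MM' : Mx j tr x = Mx j tr x' by rewrite /g MM'.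
  congr out; apply/ffunP => i'; rewrite !ffunE; case: eqP => // ii.
  (* Another player sees only slots not shown to [i], so its message ignores the bits in [O]. *)
  congr (msg _ _); apply: eq_in_imset => s; rewrite inE => /andP[a ow].
  congr edge; apply: xx; rewrite inE -(shown_world j) negb_and.
  move: a ow; rewrite ffunE => -> /eqP -> /=; exact/eqP.
apply: leq_trans (@sum_correct_guesses _ O _ (fun x => msg i (shown_share o x)) g gout _ _);
  last 2 first.
- by move=> j t x z; rewrite inE => /andP[].
- move=> j j' t x z z'; rewrite !inE => /and3P[_ cj _] /and3P[_ cj' _] zz.
  move: cj cj'; rewrite /coloured zz; case: (o z'.1.1) => // -[b [c|]] //.
  by move=> /eqP -> /eqP ->.
apply: leq_sum => x _; rewrite [leqRHS]big_mkcond; apply: leq_sum => j _.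
rewrite /gain outE; case: ifP => // MG.
set M := Mx _ _ _ in MG *.
have -> : [forall z in g j (msg i (shown_share o x)) x, x z.1 == z.2].
  apply/forallP => z; apply/implyP; rewrite inE => /and3P[_ _ zM].
  by have [_ ->] := mem_graph iotaI (fintype.subsetP MG _ zM).
rewrite /hits.
apply: leq_trans (leq_imset_card (fun z : slot B D d * bool => z.1.1) _).
apply/subset_leq_card/fintype.subsetP => v; rewrite inE /found ffunE => h.
case E : (o v) h (oN v) => [[l0 i0]|[b c]] /=.
  by move=> /andP[/eqP -> _] /(_ l0); rewrite eqxx.
case: ifP => // /eqP cj; case S : (single b) => [l|] // /andP[_ eM] _.
apply/imsetP; exists ((v, l), x (v, l)) => //.
rewrite !inE /= eM /coloured E cj eqxx /= !andbT.
by have /eqP := S; rewrite single_spec => /forallP/(_ l); rewrite eqxx => /eqP.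
Qed.

Lemma sum_worlds j (F : {ffun right B D -> state d k} -> R) :
  (1 < k)%N -> (0 < d)%N ->
  \sum_(o : {ffun right B D -> world_state}) (\prod_v world_weight (o v)) * F (worlds j o) =
  \sum_(st : {ffun right B D -> state d k}) (\prod_v weight (st v)) * F st.
Proof.
move=> k1 d0; rewrite (sum_prod_push (fun _ => world_weight) (fun _ => world j)).
by apply: eq_bigr => st _; congr (_ * _); apply: eq_bigr => v _; rewrite world_push.
Qed.

(** Each of the [r] worlds has the true law, so [r] times the expected gain is the expectation of
    the gains summed over coupled worlds. The bound on [r%:R * eps] keeps the coupling weights
    nonnegative. *)
Lemma sum_gain_le : (1 < k)%N -> (0 < d)%N -> (0 < r)%N -> mu <= 1 ->
  r%:R * eps <= mu / k%:R ^+ d ->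
  r%:R * (\sum_(st : {ffun right B D -> state d k}) (\prod_v weight (st v)) *
    (\sum_(x : {ffun slot B D d -> bool}) gain st x i)%:R) <=
  \sum_(st : {ffun right B D -> state d k}) (\prod_v weight (st v)) *
    (\sum_(x : {ffun slot B D d -> bool}) (2 * size (msg i (share iota st x i)) + r + 2))%:R.
Proof.
move=> k1 d0 r0 mu1 reps.
have e0 : 0 <= eps.
  by rewrite /eps !divr_ge0 ?exprn_ge0 ?mulr_ge0 ?subr_ge0.
have ww0 o : 0 <= world_weight o.
  case: o => [[l i']|[b [c|]]] /=; case: ifP => // _.
  - by rewrite divr_ge0 ?subr_ge0 // mulr_ge0.
  - by rewrite addr_ge0 // subr_ge0.
  - by apply: le_trans reps; rewrite mulr_ge0.
(* The right side only involves the view of [i], which all worlds share, so world 0 can represent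
   it. *)
rewrite -[leRHS](sum_worlds (Ordinal r0)) //.
have -> : r%:R * (\sum_(st : {ffun right B D -> state d k}) (\prod_v weight (st v)) *
    (\sum_(x : {ffun slot B D d -> bool}) gain st x i)%:R) =
    \sum_(j < r) \sum_(o : {ffun right B D -> world_state}) (\prod_v world_weight (o v)) *
      (\sum_(x : {ffun slot B D d -> bool}) gain (worlds j o) x i)%:R.
  under [RHS]eq_bigr => j _ do
    rewrite (sum_worlds j (fun st => (\sum_(x : {ffun slot B D d -> bool}) gain st x i)%:R)) //.
  by rewrite sumr_const card_ord mulr_natl.
rewrite exchange_big /=; apply: ler_sum => o _; rewrite -big_distrr /=.
(* A nonzero weight excludes the hidden states of player [i], as [sum_gain_worlds] requires. *)
have [->|W0] := eqVneq (\prod_v world_weight (o v)) 0; first by rewrite !mul0r.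
rewrite ler_wpM2l ?prodr_ge0 // -natr_sum ler_nat exchange_big /=.
under [leqRHS]eq_bigr => x _ do rewrite share_worlds.
apply: sum_gain_worlds => v l; apply: contra W0 => /eqP ov.
by rewrite (bigD1 v) //= ov /= eqxx mul0r.
Qed.
End Player.
End Coupling.

(** * Expected number of hidden edges in the output *)

Lemma sum_prod_at (R : comNzRingType) (I T : finType) (w F : T -> R) (i : I) :
  \sum_t w t = 1 ->
  \sum_(f : {ffun I -> T}) (\prod_j w (f j)) * F (f i) = \sum_t w t * F t.
Proof.
move=> w1.
transitivity (\sum_(f : {ffun I -> T}) \prod_j (w (f j) * (if j == i then F (f j) else 1))).
  by apply: eq_bigr => f _; rewrite big_split /= -big_mkcond big_pred1_eq.
rewrite (sum_prod_ffun (fun j t => w t * (if j == i then F t else 1))).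
rewrite (bigD1 i) //= eqxx [X in _ * X]big1 ?mulr1 // => j /negPf ->.
by under eq_bigr do rewrite mulr1.
Qed.

Lemma sum_prod_at2 (R : comNzRingType) (I T : finType) (w F G : T -> R) (i j : I) :
  \sum_t w t = 1 -> i != j ->
  \sum_(f : {ffun I -> T}) (\prod_l w (f l)) * (F (f i) * G (f j)) =
  (\sum_t w t * F t) * (\sum_t w t * G t).
Proof.
move=> w1 ij.
transitivity (\sum_(f : {ffun I -> T}) \prod_l (w (f l) *
    ((if l == i then F (f l) else 1) * (if l == j then G (f l) else 1)))).
  by apply: eq_bigr => f _; rewrite !big_split /= -!big_mkcond !big_pred1_eq.
rewrite (sum_prod_ffun (fun l t => w t *
  ((if l == i then F t else 1) * (if l == j then G t else 1)))).
rewrite (bigD1 i) //= (bigD1 j) /=; last by rewrite eq_sym.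
rewrite !eqxx (negPf ij) eq_sym (negPf ij) [X in _ * (_ * X)]big1 ?mulr1.
  by congr (_ * _); apply: eq_bigr => t _; rewrite ?mulr1 ?mul1r.
move=> l /andP[/negPf -> /negPf ->].
by under eq_bigr do rewrite !mulr1.
Qed.

Section Expectation.
Variables (R : realType) (n k d D B : nat) (iota : vertex B D d -> 'I_n).
Hypothesis iotaI : injective iota.
Variables (mu alpha : R) (msg : 'I_k -> edge_set n -> seq bool)
  (out : {ffun 'I_k -> seq bool} -> edge_set n).
Hypotheses (k1 : (1 < k)%N) (d0 : (0 < d)%N) (mu0 : 0 <= mu) (mu1 : mu <= 1)
  (alpha1 : 1 <= alpha).
Implicit Types (v u : right B D) (st : {ffun right B D -> state d k})
  (x : {ffun slot B D d -> bool}).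

Local Notation w := (@weight R k d mu).
Local Notation law st := (\prod_v w (st v)).
Local Notation N := (#|{: right B D}|).
Local Notation numbits := (#|{: {ffun slot B D d -> bool}}|).

Lemma weight_ge0 (t : state d k) : 0 <= w t.
Proof.
by case: t => [z|b] /=; rewrite divr_ge0 ?subr_ge0 ?mulr_ge0 ?exprn_ge0.
Qed.

Lemma sum_weight_hidden (P : pred 'I_d) :
  \sum_(t : state d k) w t * (if t is inl (l, _) then P l else false)%:R =
  (1 - mu) / d%:R * #|P|%:R.
Proof.
have kn : (k%:R : R) != 0 by rewrite pnatr_eq0 -lt0n ltnW.
rewrite big_sumType /= [X in _ + X]big1 ?addr0; last by move=> b _; rewrite mulr0.
rewrite (eq_bigr (fun z : 'I_d * 'I_k => (1 - mu) / (d%:R * k%:R) * (P z.1)%:R)); last by case.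
rewrite -(pair_bigA _ (fun l (i : 'I_k) => (1 - mu) / (d%:R * k%:R) * (P l)%:R)) /=.
under eq_bigr do rewrite sumr_const card_ord -[_ *+ k]mulr_natr.
rewrite -mulr_suml -mulr_sumr -natr_sum -big_mkcond sum1_card.
have dn : (d%:R : R) != 0 by rewrite pnatr_eq0 -lt0n.
by field; rewrite kn dn.
Qed.

Lemma sum_weight_cover :
  \sum_(t : state d k) w t * (hidden_slot t == None)%:R = mu.
Proof.
have kn : (k%:R : R) != 0 by rewrite pnatr_eq0 -lt0n ltnW.
rewrite big_sumType /= big1 ?add0r; last by move=> [l i] _; rewrite mulr0.
rewrite (eq_bigr (fun _ => mu / k%:R ^+ d)); last by move=> b _; rewrite /= mulr1.
by rewrite sumr_const card_ffun !card_ord -[_ *+ (_ ^ _)]mulr_natr natrX divfK // expf_neq0.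
Qed.

Lemma sum_weight : \sum_(t : state d k) w t = 1.
Proof.
have dn : (d%:R : R) != 0 by rewrite pnatr_eq0 -lt0n.
rewrite (eq_bigr (fun t => w t * (hidden_slot t == None)%:R +
   w t * (if t is inl (l, _) then predT l else false)%:R)); last first.
  by case=> [[l i]|b] _; rewrite /= mulr0 mulr1 ?addr0 ?add0r.
by rewrite big_split /= sum_weight_cover (sum_weight_hidden predT) card_ord divfK ?subrKC.
Qed.

Lemma sum_law : \sum_(st : {ffun right B D -> state d k}) law st = 1.
Proof. by rewrite (sum_prod_ffun (fun _ => w)) big1 // => v _; exact: sum_weight. Qed.

Lemma mean_covers :
  \sum_(st : {ffun right B D -> state d k}) law st * (covers st)%:R = mu * N%:R.
Proof.
have cE st : (covers st)%:R = \sum_v (hidden_slot (st v) == None)%:R :> R.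
  rewrite /covers -sum1_card big_mkcond natr_sum; apply: eq_bigr => v _.
  by rewrite inE; case: eqP.
under eq_bigr do rewrite cE big_distrr /=.
rewrite exchange_big /=.
under eq_bigr => v _ do rewrite (sum_prod_at (fun t => (hidden_slot t == None)%:R) v sum_weight)
  sum_weight_cover.
by rewrite sumr_const mulr_natr.
Qed.

(** Two vertices are independent, so both are hidden with the same slot index with probability
    [(1 - mu) ^ 2 / d], at most [1 / d]. *)
Lemma mean_collisions :
  \sum_(st : {ffun right B D -> state d k}) law st * (collisions st)%:R <=
  N%:R * (D%:R / d%:R).
Proof.
have dn : (d%:R : R) != 0 by rewrite pnatr_eq0 -lt0n.
have hid l : \sum_(t : state d k) w t * (hidden_slot t == Some l)%:R = (1 - mu) / d%:R.
  have := sum_weight_hidden (pred1 l); rewrite card1 mulr1 => <-.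
  by apply: eq_bigr => -[[l' i]|b].
under eq_bigr => st _.
  rewrite /collisions natr_sum big_distrr /=.
  under eq_bigr => v _.
    rewrite natr_sum big_distrr /=.
    under eq_bigr => u _.
      rewrite natr_sum big_distrr /=.
      under eq_bigr do rewrite natrM.
      over.
    over.
  over.
rewrite exchange_big /= mulr_natl -[leRHS]sumr_const; apply: ler_sum => v _.
rewrite exchange_big /=.
(* Adding the diagonal [u = v] makes it a sum over all [D] vertices of the block. *)
apply: (@le_trans _ _ (\sum_(u : right B D | u.1 == v.1) d%:R^-1)); last first.
  rewrite (reindex (fun a => (v.1, a))) /=; last first.
    exists snd => [//|[b a]]; rewrite inE /= => /eqP -> //.
  by rewrite (eq_bigl predT) => [|a]; rewrite ?eqxx // sumr_const card_ord mulr_natl.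
rewrite [leRHS](bigID (fun u => u != v)) /= ler_wpDr ?sumr_ge0 //.
rewrite [leRHS](eq_bigl (fun u => (u != v) && (u.1 == v.1))); last by move=> u; rewrite andbC.
apply: ler_sum => u /andP[uv _].
rewrite exchange_big /=.
under eq_bigr => l _ do rewrite (sum_prod_at2 (fun t => (hidden_slot t == Some l)%:R)
  (fun t => (hidden_slot t == Some l)%:R) sum_weight uv) hid.
rewrite sumr_const card_ord -[_ *+ d]mulr_natr -[leLHS]mulrA divfK // mulrAC.
by rewrite ler_piMl ?invr_ge0 // mulr_ile1 ?subr_ge0 // gerBl.
Qed.

Definition succeeds st x : bool :=
  `[< approx_matching (graph iota st x) (outcome iota msg out st x) alpha >].

(** Combines the lower bound on [MM] with the upper bound on the output size. Cover vertices enter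
    both, once divided by [alpha >= 1], whence the factor 2. *)
Lemma succeeds_le st x :
  N%:R / alpha * (succeeds st x)%:R <=
  (\sum_i gain iota msg out st x i)%:R + 2 * (covers st)%:R + (collisions st)%:R / alpha.
Proof.
have a0 : 0 < alpha by apply: lt_le_trans alpha1.
rewrite /succeeds; case: asboolP => [[isM hM]|_]; last first.
  by rewrite mulr0 !addr_ge0 ?mulr_ge0 ?invr_ge0 // ltW.
rewrite mulr1 ler_pdivrMr //.
have cM : (#|outcome iota msg out st x| <= covers st + \sum_i gain iota msg out st x i)%N.
  rewrite (leq_trans (card_matching_le iotaI isM)) // leq_add2l leq_sum // => i _.
  by rewrite /gain; case/andP: isM => ->.
have := MM_graph_ge iotaI st x.
move: hM cM; rewrite ler_pdivrMr //.
set M := outcome _ _ _ _ _; set S := (\sum_i _)%N => hM cM cN.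
rewrite !mulrDl divfK ?gt_eqF //.
have cM' : (#|M|%:R : R) <= (covers st)%:R + S%:R by rewrite -natrD ler_nat.
have cN' : (N%:R : R) <= (MM (graph iota st x))%:R + (covers st)%:R + (collisions st)%:R.
  by rewrite -!natrD ler_nat.
have h1 : #|M|%:R * alpha <= ((covers st)%:R + S%:R) * alpha by rewrite ler_wpM2r // ltW.
have h2 : (covers st)%:R <= (covers st)%:R * alpha by rewrite ler_peMr.
lra.
Qed.

(** Averages [succeeds_le]; the total expected gain [K] is bounded by adding [sum_gain_le] over the
    players, whose message lengths total at most [s]. *)
Lemma sum_succeeds_le (s : R) (r : nat) :
  (0 < r)%N -> r%:R * eps k d mu <= mu / k%:R ^+ d ->
  (forall st x, (\sum_i size (msg i (share iota st x i)))%:R <= s) ->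
  N%:R / alpha * (\sum_(st : {ffun right B D -> state d k}) law st *
    (\sum_(x : {ffun slot B D d -> bool}) (succeeds st x)%:R)) <=
  ((2 * s + k%:R * (r%:R + 2)) / r%:R + 2 * (mu * N%:R) + N%:R * (D%:R / d%:R) / alpha)
    * numbits%:R.
Proof.
move=> r0 reps hs.
have a0 : 0 < alpha by apply: lt_le_trans alpha1.
have law0 st : 0 <= law st by apply: prodr_ge0 => v _; exact: weight_ge0.
have r0' : (0 : R) < r%:R by rewrite ltr0n.
pose K := \sum_(st : {ffun right B D -> state d k}) law st *
    (\sum_i \sum_(x : {ffun slot B D d -> bool}) (gain iota msg out st x i)%:R).
have Kle : r%:R * K <= (2 * s + k%:R * (r%:R + 2)) * numbits%:R.
  have -> : K = \sum_i \sum_(st : {ffun right B D -> state d k}) law st *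
    (\sum_(x : {ffun slot B D d -> bool}) gain iota msg out st x i)%:R.
    rewrite /K; under eq_bigr => st _ do rewrite big_distrr /=.
    rewrite exchange_big /=; apply: eq_bigr => i _; apply: eq_bigr => st _.
    by rewrite natr_sum.
  rewrite big_distrr /=.
  apply: (@le_trans _ _ (\sum_i \sum_(st : {ffun right B D -> state d k}) law st *
    (\sum_(x : {ffun slot B D d -> bool})
       (2 * size (msg i (share iota st x i)) + r + 2))%:R)).
    by apply: ler_sum => i _; apply: sum_gain_le.
  rewrite exchange_big /=.
  set rhs := leRHS; have -> : rhs = (\sum_(st : {ffun right B D -> state d k}) law st) * rhs.
    by rewrite sum_law mul1r.
  rewrite {}/rhs.
  rewrite mulr_suml; apply: ler_sum => st _.
  rewrite -mulr_sumr ler_wpM2l // -natr_sum exchange_big /= natr_sum.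
  rewrite mulr_natr -[leRHS]sumr_const; apply: ler_sum => x _.
  rewrite !big_split /= !sum_nat_const card_ord muln0 addn0.
  by rewrite !natrD !natrM; have := hs st x; move: (\sum_i _)%N => S; lra.
rewrite big_distrr /=.
apply: (@le_trans _ _ (K + (2 * (mu * N%:R) + N%:R * (D%:R / d%:R) / alpha) * numbits%:R)); last first.
  rewrite -[_ / r%:R + _ + _]addrA [leRHS]mulrDl lerD2r [leRHS]mulrAC ler_pdivlMr // mulrC.
  exact: Kle.
apply: (@le_trans _ _ (\sum_(st : {ffun right B D -> state d k}) (law st *
    (\sum_i \sum_(x : {ffun slot B D d -> bool}) (gain iota msg out st x i)%:R) +
    (law st * (covers st)%:R * 2 + law st * (collisions st)%:R / alpha) * numbits%:R))).
  apply: ler_sum => st _; rewrite mulrCA.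
  have -> : (law st * (covers st)%:R * 2 + law st * (collisions st)%:R / alpha) * numbits%:R =
    law st * (((covers st)%:R * 2 + (collisions st)%:R / alpha) * numbits%:R) by ring.
  rewrite -mulrDr ler_wpM2l //.
  set c := (_ + _ / alpha); have -> : c * numbits%:R =
    \sum_(x : {ffun slot B D d -> bool}) c by rewrite sumr_const mulr_natr.
  rewrite exchange_big /= -big_split /= mulr_sumr; apply: ler_sum => x _; rewrite /c.
  by have := succeeds_le st x; rewrite natr_sum mulrC; lra.
rewrite big_split /= lerD2l -mulr_suml ler_wpM2r // big_split /= -!mulr_suml mean_covers.
rewrite [leLHS]addrC [leRHS]addrC [_ * 2]mulrC lerD2r ler_wpM2r ?invr_ge0 ?(ltW a0) //.
exact: mean_collisions.
Qed.
End Expectation.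

(** * Averaging over coins and edge partitions *)

(** Integrates over the coins a bound valid for each coin value, reducing to deterministic
    protocols. *)
Lemma sum_probability_le (R : realType) (d : measure_display) (T : measurableType d)
    (P : probability T R) (Z : finType) (W : Z -> R) (A : Z -> set T) (c : R) :
  (forall z, 0 <= W z) -> (forall z, measurable (A z)) ->
  (forall t, \sum_z W z * `[< A z t >]%:R <= c) ->
  \sum_z W z * fine (P (A z)) <= c.
Proof.
move=> W0 mA hc.
have PAE z : P (A z) = (fine (P (A z)))%:E by rewrite fineK // fin_num_measure.
rewrite -lee_fin -sumEFin.
have -> : (\sum_z (W z * fine (P (A z)))%:E)%E =
    (\sum_z \int[P]_t (W z * \1_(A z) t)%:E)%E.
  apply: eq_bigr => z _; rewrite (integralZl_indic measurableT (fun=> A z)) //; last first.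
    by move=> Wn; have := W0 z; rewrite leNgt Wn.
  by rewrite integral_indic // setIT EFinM -PAE.
rewrite -ge0_integral_sum //; last 2 first.
- move=> z; apply/measurable_EFinP; apply: measurable_funM => //.
  - by move=> z t _; rewrite lee_fin mulr_ge0.
apply: (@le_trans _ _ (\int[P]_t (cst c%:E t))%E); last first.
  by rewrite integral_cst // [X in (_ * X)%E](_ : _ = 1%E) ?mule1 //; exact: probability_setT.
apply: ge0_le_integral => //.
- by move=> t _; apply: sume_ge0 => z _; rewrite lee_fin mulr_ge0.
- apply: emeasurable_sum => z; apply/measurable_EFinP; apply: measurable_funM => //.
- move=> t _; rewrite sumEFin lee_fin; apply: le_trans (hc t).
  by apply: ler_sum => z _; rewrite indicE.
Qed.

(** There are countably many transcripts and finitely many outputs, so the event is a countable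
    union of measurable ones. *)
Lemma measurable_approx (R : realType) (d : measure_display) (T : measurableType d)
    (n k : nat) (Pi : protocol T n k) (G : edge_set n) (a : assignment n k) (alpha : R) :
  measurable [set w | approx_matching G (run Pi G a w) alpha]%classic.
Proof.
have mrun (M : edge_set n) : measurable [set w | run Pi G a w = M]%classic.
  have -> : [set w | run Pi G a w = M]%classic =
      (\bigcup_(t : {ffun 'I_k -> seq bool})
        ([set w | output Pi w t = M] `&`
         \bigcap_(i in [set: 'I_k]) [set w | message Pi i w (player_edges G a i) = t i]))%classic.
    apply/seteqP; split => [w /= rM|w [t _ [/= oM tE]]] /=.
      exists (transcript Pi G a w) => //; split => // i _ /=.
      by rewrite ffunE.
    rewrite /run -oM; congr (output Pi w _); apply/ffunP => i; rewrite ffunE.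
    exact: tE.
  apply: countable_bigcupT_measurable => [|t]; first exact: countableP.
  apply: measurableI; first exact: measurable_output.
  by apply: fin_bigcap_measurable => // i _; exact: measurable_message.
have -> : [set w | approx_matching G (run Pi G a w) alpha]%classic =
   (\bigcup_(M in [set M | approx_matching G M alpha]) [set w | run Pi G a w = M])%classic.
  by apply/seteqP; split => [w h|w [M h /= ->] //]; exists (run Pi G a w).
by apply: fin_bigcup_measurable => // M _; exact: mrun.
Qed.

Section Average.
Variables (R : realType) (n k d D B : nat) (iota : vertex B D d -> 'I_n) (mu : R).
Hypotheses (iotaI : injective iota) (k0 : (0 < k)%N) (d0 : (0 < d)%N).
Implicit Types (h : {ffun right B D -> option 'I_d}) (x : {ffun slot B D d -> bool})
  (a : assignment n k) (c : option 'I_d) (b : {ffun 'I_d -> 'I_k}).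

(** A type is a state without its owners: [Some l] for hidden, [None] for cover. Types and bits
    determine the graph; the owners come from the random edge partition. *)
Definition type_weight c : R := if c is Some _ then (1 - mu) / d%:R else mu.

Definition state_of c b : state d k := if c is Some l then inl (l, b l) else inr b.

Definition states h x a : {ffun right B D -> state d k} :=
  [ffun v => state_of (h v) [ffun l => a (edge iota (v, l) (x (v, l)))]].

Definition type_graph h x : edge_set n :=
  [set edge iota s (x s) | s : slot B D d & if h s.1 is Some l then s.2 == l else true]%SET.

Lemma graph_states h x a : graph iota (states h x a) x = type_graph h x.
Proof.
rewrite /graph /type_graph; have -> // : [set s | active (states h x a s.1) s.2]%SET =
  [set s : slot B D d | if h s.1 is Some l then s.2 == l else true]%SET.
by apply/setP => s; rewrite !inE ffunE /state_of; case: (h s.1).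
Qed.

Lemma share_states h x a i :
  share iota (states h x a) x i = player_edges (type_graph h x) a i.
Proof.
have ow s : owner (states h x a s.1) s.2 = a (edge iota s (x s)) \/
    ~~ active (states h x a s.1) s.2.
  rewrite ffunE /state_of; case: s => v l /=; case: (h v) => [l0|] /=.
    by rewrite ffunE; case: eqP => [->|]; [left|right].
  by left; rewrite ffunE.
rewrite -(graph_states h x a) /player_edges; apply/setP => e; rewrite inE; apply/imsetP/andP.
  move=> [s]; rewrite inE => /andP[ac os] ->; split.
    by apply/imsetP; exists s => //; rewrite inE.
  by case: (ow s) => [<- //|]; rewrite ac.
move=> [/imsetP[s]]; rewrite inE => ac -> ae; exists s => //; rewrite inE /sees ac /=.
by case: (ow s) => [->//|]; rewrite ac.
Qed.

Lemma sum_unif : \sum_(i : 'I_k) (k%:R^-1 : R) = 1.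
Proof.
by rewrite sumr_const card_ord -[_ *+ k]mulr_natr mulVf // pnatr_eq0 -lt0n.
Qed.

(** Distinct slots give distinct edges, so a uniform assignment yields independent uniform owners.
    Drawing the types first and then the partition thus reproduces the law [weight]. *)
Lemma mean_states (F : {ffun right B D -> state d k} -> R) x :
  \sum_(h : {ffun right B D -> option 'I_d}) (\prod_v type_weight (h v)) *
    (#|{: assignment n k}|%:R^-1 * \sum_(a : assignment n k) F (states h x a)) =
  \sum_(st : {ffun right B D -> state d k}) (\prod_v weight mu (st v)) * F st.
Proof.
(* The conditional probability of state [t] given type [c]. *)
pose q (c : option 'I_d) (t : state d k) : R :=
  \sum_(b | state_of c b == t) \prod_(l : 'I_d) k%:R^-1.
have key h : #|{: assignment n k}|%:R^-1 * \sum_(a : assignment n k) F (states h x a) =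
    \sum_(st : {ffun right B D -> state d k}) (\prod_v q (h v) (st v)) * F st.
  transitivity (\sum_(a : assignment n k) (\prod_(e : {set 'I_n}) (k%:R^-1 : R)) * F (states h x a)).
    by rewrite -big_distrr /= prodr_const card_ffun card_ord natrX exprVn.
  pose G (f : {ffun slot B D d -> 'I_k}) : R := F [ffun v => state_of (h v) [ffun l => f (v, l)]].
  transitivity (\sum_(a : assignment n k) (\prod_(e : {set 'I_n}) (k%:R^-1 : R)) *
      G [ffun s => a (edge iota s (x s))]).
    apply: eq_bigr => a _; congr (_ * F _); apply/ffunP => v; rewrite !ffunE.
    by congr state_of; apply/ffunP => l; rewrite !ffunE.
  rewrite (sum_prod_restrict G sum_unif); last by move=> s s' /(edge_inj iotaI)[].
  (* Currying regroups the slot owners by right vertex. *)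
  rewrite (reindex (fun f : {ffun right B D -> {ffun 'I_d -> 'I_k}} =>
     [ffun s : slot B D d => f s.1 s.2])); last first.
    exists (fun f : {ffun slot B D d -> 'I_k} => [ffun v => [ffun l => f (v, l)]]) => f _.
      by apply/ffunP => v; apply/ffunP => l; rewrite !ffunE.
    by apply/ffunP => -[v l]; rewrite !ffunE.
  transitivity (\sum_(f : {ffun right B D -> {ffun 'I_d -> 'I_k}})
     (\prod_(v : right B D) \prod_(l : 'I_d) (k%:R^-1 : R)) * F [ffun v => state_of (h v) (f v)]).
    apply: eq_bigr => f _; rewrite /G; congr (_ * _); first by rewrite pair_bigA.
    congr (F _).
    apply/ffunP => v; rewrite !ffunE; congr state_of.
    by apply/ffunP => l; rewrite !ffunE.
  exact: (sum_prod_push (fun _ _ => \prod_(l : 'I_d) k%:R^-1) (fun v b => state_of (h v) b) F).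
under eq_bigr do rewrite key big_distrr /=.
rewrite exchange_big /=; apply: eq_bigr => st _.
under eq_bigr do rewrite mulrA -big_split /=.
rewrite -big_distrl /=; congr (_ * _).
rewrite (sum_prod_ffun (fun v c => type_weight c * q c (st v))); apply: eq_bigr => v _.
have dn : (d%:R : R) != 0 by rewrite pnatr_eq0 -lt0n.
have kn : (k%:R : R) != 0 by rewrite pnatr_eq0 -lt0n.
have qE c t : q c t = k%:R ^- d * #|[set b | state_of c b == t]%SET|%:R.
  rewrite /q prodr_const card_ord exprVn -sum1dep_card natr_sum mulr_sumr.
  by apply: eq_bigr => b _; rewrite mulr1.
case: (st v) => [[l i]|b] /=.
  rewrite (bigD1 (Some l)) //= [X in _ + X]big1 ?addr0; last first.
    move=> c cl; rewrite qE (_ : [set b | _]%SET = finset.set0) ?cards0 ?mulr0 //.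
    apply/setP => b; rewrite !inE; apply/negP.
    by case: c cl => [l'|] cl /eqP //= [ll _]; move: cl; rewrite ll eqxx.
  rewrite invfM mulrA; congr (_ * _).
  have : \sum_(f : {ffun 'I_d -> 'I_k}) (\prod_(j : 'I_d) (k%:R^-1 : R)) * (f l == i)%:R = k%:R^-1.
    apply: etrans (sum_prod_at (fun j => (j == i)%:R) l sum_unif) _.
    rewrite (bigD1 i) //= eqxx mulr1.
    by rewrite big1 ?addr0 // => j /negPf ->; rewrite mulr0.
  move=> <-; rewrite /q [LHS]big_mkcond; apply: eq_bigr => b _.
  have -> : (state_of (Some l) b == inl (l, i)) = (Some l == Some l) && (b l == i) by [].
  by rewrite eqxx /=; case: eqP; rewrite ?mulr1 ?mulr0.
rewrite (bigD1 None) //= [X in _ + X]big1 ?addr0; last first.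
  by move=> [l|] // _; rewrite qE (_ : [set b | _]%SET = finset.set0) ?cards0 ?mulr0 //.
by rewrite /q (big_pred1 b) ?prodr_const ?card_ord ?exprVn.
Qed.
End Average.

(** The averaging half of Yao's principle: success [p] on every graph gives success [p] on the hard
    distribution, which is bounded above for each fixed coin value by [sum_succeeds_le]. *)
Lemma approximates_bound (R : realType) (t : measure_display) (T : measurableType t)
    (P : probability T R) (n k d D B r : nat) (iota : vertex B D d -> 'I_n)
    (Pi : protocol T n k) (p alpha mu s : R) :
  injective iota -> (1 < k)%N -> (0 < d)%N -> (0 < r)%N -> 0 <= mu -> mu <= 1 ->
  1 <= alpha -> r%:R * eps k d mu <= mu / k%:R ^+ d ->
  (forall (G : edge_set n) a w, simple_graph G ->
     (\sum_(i < k) size (transcript Pi G a w i))%:R <= s) ->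
  approximates P Pi alpha p ->
  p * ((B * D)%:R / alpha) <=
    (2 * s + k%:R * (r%:R + 2)) / r%:R + 2 * (mu * (B * D)%:R) +
    (B * D)%:R * (D%:R / d%:R) / alpha.
Proof.
move=> iotaI k1 d0 r0 mu0 mu1 a1 reps hs happ.
have k0 := ltnW k1.
have a0 : 0 < alpha by apply: lt_le_trans a1.
have NE : #|{: right B D}| = (B * D)%N by rewrite card_prod !card_ord.
pose bits := {ffun slot B D d -> bool}.
pose tw (h : {ffun right B D -> option 'I_d}) : R := \prod_v type_weight mu (h v).
have tw0 h : 0 <= tw h.
  apply: prodr_ge0 => v _; case: (h v) => [l|] //=.
  by rewrite divr_ge0 // subr_ge0.
have sum_tw : \sum_h tw h = 1.
  rewrite (sum_prod_ffun (fun _ => type_weight mu)) big1 // => v _.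
  have dn : (d%:R : R) != 0 by rewrite pnatr_eq0 -lt0n.
  rewrite sum_option /= sumr_const card_ord -[_ *+ d]mulr_natr divfK //.
  by rewrite addrC subrK.
pose NA := (#|{: assignment n k}|%:R : R).
pose Z : finType := ({ffun right B D -> option 'I_d} * (bits * assignment n k))%type.
pose W (z : Z) : R := (B * D)%:R / alpha * (tw z.1 * NA^-1).
pose A (z : Z) := [set w | approx_matching (type_graph iota z.1 z.2.1)
   (run Pi (type_graph iota z.1 z.2.1) z.2.2 w) alpha]%classic.
have sumZ (f : Z -> R) : \sum_z f z = \sum_h \sum_(x : bits) \sum_(a : assignment n k) f (h, (x, a)).
  rewrite (eq_bigr (fun z : Z => f (z.1, z.2))); last by case.
  rewrite -(pair_bigA _ (fun h q => f (h, q))) /=; apply: eq_bigr => h _.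
  rewrite (eq_bigr (fun q => f (h, (q.1, q.2)))); last by case.
  by rewrite -(pair_bigA _ (fun x a => f (h, (x, a)))).
set bnd := leRHS.
have B0 : 0 <= (B * D)%:R / alpha by rewrite divr_ge0 // ltW.
have upper : \sum_z W z * fine (P (A z)) <= bnd * #|{: bits}|%:R.
  apply: sum_probability_le => [z|z|w].
  - by rewrite /W mulr_ge0 // mulr_ge0 // invr_ge0.
  - exact: measurable_approx.
  pose msg i E := message Pi i w E.
  pose out tr := output Pi w tr.
  have hs' (st : {ffun right B D -> state d k}) (x : bits) :
      (\sum_i size (msg i (share iota st x i)))%:R <= s.
    (* Realises the shares by an edge assignment, so that the bound on transcripts applies; the
       default player only receives sets that are not edges. *)
    pose asg : assignment n k := [ffun e => odflt (Ordinal k0) [pick i | e \in share iota st x i]].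
    have E i : share iota st x i = player_edges (graph iota st x) asg i.
      apply/setP => e; rewrite inE; apply/idP/andP => [es|[eg]].
        split; first by case/imsetP: es => s'; rewrite inE => /andP[ac _] ->;
          apply/imsetP; exists s' => //; rewrite inE.
        rewrite ffunE; case: pickP => [j js|/(_ i)]; last by rewrite es.
        case/imsetP: es js => s'; rewrite inE => /andP[_ /eqP oi] ->.
        by case/imsetP => s''; rewrite inE => /andP[_ /eqP oj] /(edge_inj iotaI)[ss _];
          rewrite -oi -oj ss.
      rewrite ffunE; case: pickP => [j js /eqP <- //|none].
      case/imsetP: eg => s'; rewrite inE => ac es.
      have := none (owner (st s'.1) s'.2); rewrite es => /negP[].
      by apply/imsetP; exists s' => //; rewrite inE /sees ac eqxx.
    apply: le_trans (hs (graph iota st x) asg w (graph_simple iotaI st x)).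
    by rewrite ler_nat leq_sum // => i _; rewrite ffunE -E.
  have := sum_succeeds_le iotaI out k1 d0 mu0 mu1 a1 r0 reps hs'.
  rewrite NE -/bnd; apply: le_trans.
  rewrite sumZ exchange_big /=.
  have -> : \sum_(st : {ffun right B D -> state d k}) \prod_v weight mu (st v) *
      (\sum_(x : bits) (succeeds iota alpha msg out st x)%:R) =
    \sum_(x : bits) \sum_(st : {ffun right B D -> state d k}) (\prod_v weight mu (st v)) *
      (succeeds iota alpha msg out st x)%:R.
    by rewrite exchange_big /=; apply: eq_bigr => st _; rewrite mulr_sumr.
  rewrite mulr_sumr; apply: ler_sum => x _.
  rewrite -(mean_states mu iotaI k0 d0 (fun st => (succeeds iota alpha msg out st x)%:R) x).
  rewrite mulr_sumr; apply: ler_sum => h _.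
  rewrite mulrA mulr_sumr -/(tw h) mulr_sumr; apply: ler_sum => a _.
  have -> : succeeds iota alpha msg out (states iota h x a) x = `[< A (h, (x, a)) w >].
    rewrite /succeeds graph_states (_ : outcome _ _ _ _ _ = run Pi (type_graph iota h x) a w) //.
    rewrite /outcome /run; congr (output Pi w _); apply/ffunP => i.
    by rewrite !ffunE share_states.
  by rewrite /W /= !mulrA.
rewrite -(ler_pM2r (_ : 0 < #|{: bits}|%:R)); last first.
  by rewrite card_ffun card_bool ltr0n expn_gt0.
apply: le_trans upper; rewrite sumZ.
set lhs := leLHS; have -> : lhs = (\sum_h tw h) * lhs by rewrite sum_tw mul1r.
rewrite {}/lhs mulr_suml; apply: ler_sum => h _.
have -> : p * ((B * D)%:R / alpha) * #|{: bits}|%:R =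
    \sum_(x : bits) p * ((B * D)%:R / alpha) by rewrite sumr_const mulr_natr.
rewrite mulr_sumr; apply: ler_sum => x _.
have sG : simple_graph (type_graph iota h x).
  pose asg : assignment n k := [ffun=> Ordinal k0].
  by rewrite -(graph_states iota h x asg) graph_simple.
have := happ _ sG; rewrite /success_prob.
have PAE a : P [set w | approx_matching (type_graph iota h x)
    (run Pi (type_graph iota h x) a w) alpha]%classic = (fine (P (A (h, (x, a)))))%:E.
  by rewrite fineK // fin_num_measure //; exact: measurable_approx.
under eq_bigr do rewrite PAE.
rewrite sumEFin -EFinM lee_fin => hp.
have -> : \sum_(a : assignment n k) W (h, (x, a)) * fine (P (A (h, (x, a)))) =
    ((B * D)%:R / alpha * tw h) *
      (NA^-1 * \sum_(a : assignment n k) fine (P (A (h, (x, a))))).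
  by rewrite !mulr_sumr; apply: eq_bigr => a _; rewrite /W /= !mulrA.
have -> : tw h * (p * ((B * D)%:R / alpha)) = ((B * D)%:R / alpha * tw h) * p by ring.
by apply: ler_wpM2l => //; rewrite mulr_ge0.
Qed.

(** * Choice of parameters *)

(** Bernoulli's inequality for [(1 - 1 / k) ^ m], cleared of denominators. *)
Lemma pow_pred_ge (R : realFieldType) (k m : nat) :
  (0 < k)%N -> k%:R ^+ m * (k%:R - m%:R) <= k%:R * k.-1%:R ^+ m :> R.
Proof.
move=> k0; have kE : (k.-1%:R : R) = k%:R - 1 by rewrite -[in RHS](prednK k0) -natr1 addrK.
elim: m => [|m IH]; first by rewrite !expr0 subr0 mul1r mulr1.
apply: (@le_trans _ _ (k.-1%:R * (k%:R ^+ m * (k%:R - m%:R)))).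
  rewrite exprS mulrAC [leRHS]mulrCA [leLHS]mulrC ler_wpM2l ?exprn_ge0 //.
  by rewrite kE -natr1; have : (0 : R) <= m%:R by []; nra.
by rewrite exprS [leRHS]mulrCA ler_wpM2l.
Qed.

(** For [2 * d <= k], Bernoulli's inequality bounds [(k / (k - 1)) ^ (d - 1)] by 2, so [eps * k ^ d]
    is at most [2 / d]. *)
Lemma eps_le (R : realFieldType) (k d r : nat) (mu : R) :
  (1 < k)%N -> (0 < d)%N -> (2 * d <= k)%N -> 0 <= mu ->
  r%:R <= mu * d%:R / 2 -> r%:R * eps k d mu <= mu / k%:R ^+ d.
Proof.
move=> k1 d0 dk mu0 rle; have k0 := ltnW k1.
have kp : (0 : R) < k%:R by rewrite ltr0n.
have dp : (0 : R) < d%:R by rewrite ltr0n.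
have qp : (0 : R) < k.-1%:R ^+ d.-1 by rewrite exprn_gt0 // ltr0n -subn1 subn_gt0.
have pw : (k%:R : R) ^+ d.-1 <= 2 * k.-1%:R ^+ d.-1.
  rewrite -(ler_pM2l kp) mulrCA.
  have := @pow_pred_ge R k d.-1 k0.
  have : (k%:R : R) / 2 <= k%:R - d.-1%:R.
    have : (2 * d%:R : R) <= k%:R by rewrite -natrM ler_nat.
    have : (d.-1%:R : R) <= d%:R by rewrite ler_nat leq_pred.
    by lra.
  have : (0 : R) <= k%:R ^+ d.-1 by rewrite exprn_ge0.
  by move: (_ ^+ _) (_ ^+ _) => a b; nra.
rewrite ler_pdivlMr ?exprn_gt0 // /eps.
have -> : r%:R * ((1 - mu) / (d%:R * k%:R) / k.-1%:R ^+ d.-1) * k%:R ^+ d =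
    (r%:R * (1 - mu)) * k%:R ^+ d.-1 / (d%:R * k.-1%:R ^+ d.-1) :> R.
  rewrite -[in X in _ * _ ^+ X](prednK d0) exprS; field.
  by rewrite !gt_eqF.
rewrite ler_pdivrMr ?mulr_gt0 //.
have h1 : r%:R * (1 - mu) <= mu * d%:R / 2 by have : (0 : R) <= r%:R by []; nra.
apply: (@le_trans _ _ (mu * d%:R / 2 * k%:R ^+ d.-1)).
  by rewrite ler_wpM2r // exprn_ge0.
apply: (@le_trans _ _ (mu * d%:R / 2 * (2 * k.-1%:R ^+ d.-1))).
  by rewrite ler_wpM2l // divr_ge0 // mulr_ge0.
by rewrite le_eqVlt; apply/orP; left; apply/eqP; field.
Qed.

Lemma natr_trunc_ge_half (R : archiRealFieldType) (y : R) :
  1 <= y -> (Num.truncn y)%:R <= y /\ y / 2 <= (Num.truncn y)%:R.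
Proof.
move=> y1; have y0 : 0 <= y by apply: le_trans y1.
have /andP[h1 h2] := truncn_itv y0; split => //.
have : (1 : R) <= (Num.truncn y)%:R by rewrite (ler_nat _ 1) truncn_gt0.
by move: h2; rewrite -natr1; lra.
Qed.

Lemma half_bounds (k : nat) : (2 <= k)%N ->
  [/\ (2 * (k %/ 2) <= k)%N, (k <= 4 * (k %/ 2))%N & (0 < k %/ 2)%N].
Proof. by move=> k2; split; lia. Qed.

Lemma transcript_size_ge (R : realType) (t : measure_display) (T : measurableType t)
    (P : probability T R) (n k : nat) (Pi : protocol T n k) (p alpha s : R) :
  0 < p <= 1 -> 1 <= alpha -> 64 * alpha <= p * k%:R ->
  64 * (64 * (alpha ^+ 2 * k%:R)) <= p ^+ 2 * n%:R ->
  (forall (G : edge_set n) a w, simple_graph G ->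
     (\sum_(i < k) size (transcript Pi G a w i))%:R <= s) ->
  approximates P Pi alpha p ->
  p ^+ 3 / (2 * (128 * 192)) * (n%:R * k%:R / alpha ^+ 2) <= s.
Proof.
move=> /andP[p0 p1] a1 hk hn hs happ.
have a0 : 0 < alpha by apply: lt_le_trans a1.
have kR : 64 <= k%:R :> R.
  by have : p * k%:R <= k%:R by [rewrite ler_piMl|]; lra.
have k64 : (64 <= k)%N by rewrite -(ler_nat R).
pose d := (k %/ 2)%N.
have [d2 d4 d0] := half_bounds (leq_trans (isT : 2 <= 64)%N k64); rewrite -/d in d2 d4 d0.
have d2R : 2 * d%:R <= k%:R :> R by rewrite -natrM ler_nat.
have d4R : k%:R <= 4 * d%:R :> R by rewrite -natrM ler_nat.
have dR0 : 0 < d%:R :> R by rewrite ltr0n.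
have pk : p * k%:R <= 4 * (p * d%:R) by have := ler_wpM2l (ltW p0) d4R; lra.
have pd64 : 16 * alpha <= p * d%:R by lra.
have pdd : p * d%:R <= d%:R by rewrite ler_piMl.
(* Collisions then cost at most a quarter of [p * N / alpha], where [N = B * D]. *)
pose D := Num.truncn (p * d%:R / 4).
have [Dle Dge] : (D%:R : R) <= p * d%:R / 4 /\ p * d%:R / 4 / 2 <= D%:R.
  by apply: natr_trunc_ge_half; lra.
(* Chosen so that the cover term [2 * mu * N] is a quarter of [p * N / alpha]. *)
pose mu := p / (8 * alpha).
have muE : mu * (8 * alpha) = p by rewrite divfK // gt_eqF // mulr_gt0.
have mu0 : 0 <= mu by rewrite divr_ge0 ?(ltW p0) // mulr_ge0 // ltW.
have mu1 : mu <= 1 by rewrite ler_pdivrMr ?mulr_gt0 //; lra.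
pose r := Num.truncn (mu * d%:R / 2).
have mud : 2 <= mu * d%:R.
  by rewrite /mu mulrAC ler_pdivlMr ?mulr_gt0 //; lra.
have [rle rge] : (r%:R : R) <= mu * d%:R / 2 /\ mu * d%:R / 2 / 2 <= r%:R.
  by apply: natr_trunc_ge_half; lra.
have r0 : (0 < r)%N by rewrite -(ltr0n R); lra.
have r1 : 1 <= r%:R :> R by rewrite ler1n.
have aa : alpha <= alpha ^+ 2 by rewrite expr2 ler_peMl // ltW.
have kpos : (0 : R) <= k%:R by [].
have npos : (0 : R) <= n%:R by [].
have pp : p ^+ 2 <= 1 by rewrite expr_le1 // ltW.
have ak : 64 * (64 * (alpha * k%:R)) <= p ^+ 2 * n%:R.
  apply: le_trans hn; rewrite !ler_pM2l // ; exact: ler_wpM2r.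
have nk : 64 * (64 * k%:R) <= n%:R :> R.
  have h1 : k%:R <= alpha * k%:R by rewrite ler_peMl.
  have h2 : p ^+ 2 * n%:R <= n%:R by rewrite ler_piMl.
  by lra.
have Dd : (D <= d)%N by rewrite -(ler_nat R); lra.
(* A block uses [D] right and [2 * d] left vertices. *)
pose B := (n %/ (D + 2 * d))%N.
have Bn : (B * D + B * d * 2 <= n)%N.
  by rewrite -mulnA -mulnDr (mulnC d) leq_trunc_div.
have Bge : n%:R <= B%:R * (6 * d%:R) :> R.
  have h : n%:R < ((B + 1) * (D + 2 * d))%:R :> R.
    by rewrite ltr_nat addn1 /B ltn_ceil // addn_gt0 muln_gt0 d0 orbT.
  rewrite natrM natrD (natrD _ D) natrM in h.
  have Dd' : D%:R <= d%:R :> R by rewrite ler_nat.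
  have h3 : (B%:R + 1) * (D%:R + 2%:R * d%:R) <= (B%:R + 1) * (3 * d%:R) :> R.
    by rewrite ler_wpM2l ?addr_ge0 //; lra.
  have : n%:R < (B%:R + 1) * (3 * d%:R) :> R by exact: lt_le_trans h h3.
  (* Rounding loses at most [3 * d], which [nk] bounds by [n / 2]. *)
  by lra.
have cV : (#|{: vertex B D d}| <= n)%N.
  by rewrite card_sum !card_prod !card_ord card_bool.
pose iota (z : vertex B D d) := widen_ord cV (enum_rank z).
have iotaI : injective iota by move=> z z' /(congr1 val) /= /val_inj /enum_rank_inj.
have reps := eps_le (ltn_trans (isT : 1 < 2)%N (leq_trans (isT : 2 < 64)%N k64)) d0 d2 mu0 rle.
have := approximates_bound iotaI _ d0 r0 mu0 mu1 a1 reps hs happ.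
move=> /(_ (leq_trans (isT : 1 < 64)%N k64)).
have NE : (B * D)%:R = B%:R * D%:R :> R by rewrite natrM.
set N := ((B * D)%:R : R) in NE *.
have N0 : 0 <= N by rewrite /N.
have Nge : p * n%:R <= 48 * N.
  have h1 : B%:R * (p * d%:R / 4 / 2) <= B%:R * D%:R :> R by rewrite ler_wpM2l.
  have h2 : p * n%:R <= p * (B%:R * (6 * d%:R)) by rewrite ler_pM2l.
  by rewrite NE; lra.
have -> : 2 * (mu * N) = p * (N / alpha) / 4 by rewrite /mu; field; rewrite gt_eqF.
set X := (_ + _) / r%:R.
have -> : N * (D%:R / d%:R) / alpha = (N / alpha) * (D%:R / d%:R) by ring.
have Na0 : 0 <= N / alpha by rewrite divr_ge0 // ltW.
have Ddp : (N / alpha) * (D%:R / d%:R) <= (N / alpha) * (p / 4).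
  by rewrite ler_wpM2l // ler_pdivrMr //; lra.
move=> main.
have h1 : p * (N / alpha) / 2 <= X by lra.
have h2 : r%:R * (p * (N / alpha) / 2) <= 2 * s + k%:R * (r%:R + 2).
  by move: h1; rewrite /X ler_pdivlMr ?ltr0n // mulrC.
have h3 : k%:R * (r%:R + 2) <= k%:R * (3 * r%:R) :> R by rewrite ler_wpM2l //; lra.
(* The additive term [k * (r + 2) / r] is at most [3 * k] and absorbs another quarter, leaving the
   last one against [2 * s / r]. *)
have h4 : 3 * k%:R <= p * (N / alpha) / 4.
  rewrite mulrA ler_pdivlMr // ler_pdivlMr //.
  have : p * (p * n%:R) <= p * (48 * N) by rewrite ler_pM2l.
  have : 0 <= alpha * k%:R by rewrite mulr_ge0 // ltW.
  by move: ak; rewrite expr2 -mulrA; lra.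
have h5 : r%:R * (3 * k%:R) <= r%:R * (p * (N / alpha) / 4) by rewrite ler_wpM2l.
have h6 : r%:R * (p * (N / alpha) / 4) <= 2 * s by lra.
have h7 : p * k%:R / (128 * alpha) <= r%:R.
  apply: le_trans rge.
  have -> : mu * d%:R / 2 / 2 = 4 * (p * d%:R) / (128 * alpha) by rewrite /mu; field; rewrite gt_eqF.
  by rewrite ler_wpM2r // invr_ge0 mulr_ge0 // ltW.
have h8 : p ^+ 2 * n%:R / (192 * alpha) <= p * (N / alpha) / 4.
  have -> : p * (N / alpha) / 4 = (p * (48 * N)) / (192 * alpha) by field; rewrite gt_eqF.
  rewrite ler_wpM2r ?invr_ge0 ?mulr_ge0 ?(ltW a0) //.
  by rewrite expr2 -mulrA ler_pM2l.
have h9 : (p * k%:R / (128 * alpha)) * (p ^+ 2 * n%:R / (192 * alpha)) <= 2 * s.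
  apply: le_trans h6; apply: ler_pM => //.
    by rewrite divr_ge0 ?mulr_ge0 // ltW.
  by rewrite divr_ge0 ?mulr_ge0 ?exprn_ge0 // ltW.
have -> : p ^+ 3 / (2 * (128 * 192)) * (n%:R * k%:R / alpha ^+ 2) =
  (p * k%:R / (128 * alpha)) * (p ^+ 2 * n%:R / (192 * alpha)) / 2 by field; rewrite gt_eqF.
by rewrite ler_pdivrMr // [leRHS]mulrC.
Qed.

(** * Asymptotic form of the lower bound *)

Local Open Scope classical_set_scope.
Local Open Scope ring_scope.

Theorem theorem5 (R : realType) (p : R) (hp : 0 < p <= 1)
    (k : nat -> nat) (alpha : nat -> R)
    (halpha_pos : forall n : nat, 0 < alpha n)
    (halpha_log : alpha =Omega_\oo (fun n : nat => ln (n%:R : R)))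
    (halpha_min : alpha =o_\oo
       (fun n : nat => Num.min (Num.sqrt (n%:R / (k n)%:R)) (k n)%:R : R)) :
  exists2 c : R, 0 < c &
    \forall n \near \oo,
      ((c * (n%:R * (k n)%:R / alpha n ^+ 2))%:E
        <= simultaneous_cc n (k n) (alpha n) p)%E.
Proof.
have /andP[p0 p1] := hp.
exists (p ^+ 3 / (2 * (128 * 192))); first by rewrite divr_gt0 // exprn_gt0.
(* The logarithmic bound yields [alpha n >= 1] as soon as [ln n] exceeds the hidden constant [K]. *)
have : ((fun n : nat => ln (n%:R : R)) =O_\oo alpha).
  by rewrite -eqOmegaO -eqOmegaE.
move=> /eqO_exP[K K0 hK].
(* The constant [p / 64] in the little-o yields both size conditions of [transcript_size_ge]. *)
have e0 : 0 < p / 64 by rewrite divr_gt0.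
have /eqoP/(_ _ e0) ho := halpha_min.
near=> n.
have n0 : 0 < n%:R :> R.
  by apply: lt_le_trans (expR_gt0 K) _; near: n; exact: nbhs_infty_ger.
have a1 : 1 <= alpha n.
  have : `|ln (n%:R : R)| <= K * `|alpha n| by near: n.
  have : K <= ln (n%:R : R).
    rewrite -[leLHS](expRK K) ler_ln ?posrE ?expR_gt0 //.
    by near: n; exact: nbhs_infty_ger.
  rewrite (ger0_norm (ltW (halpha_pos n))) => h1 h2.
  rewrite -(ler_pM2l K0) mulr1; apply: le_trans h1 _.
  exact: le_trans (ler_norm _) h2.
have : `|alpha n| <= p / 64 * `|Num.min (Num.sqrt (n%:R / (k n)%:R)) (k n)%:R : R|.
  by near: n.
rewrite (ger0_norm (ltW (halpha_pos n))) ger0_norm; last first.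
  by rewrite le_min sqrtr_ge0 ler0n.
move=> hmin.
have hk : 64 * alpha n <= p * (k n)%:R.
  have : p / 64 * Num.min (Num.sqrt (n%:R / (k n)%:R)) (k n)%:R <= p / 64 * (k n)%:R.
    by rewrite ler_pM2l // ge_min lexx orbT.
  by lra.
have kp : 0 < (k n)%:R :> R.
  rewrite -(pmulr_rgt0 _ p0); apply: lt_le_trans hk; lra.
have hn : 64 * (64 * (alpha n ^+ 2 * (k n)%:R)) <= p ^+ 2 * n%:R.
  have h0 : alpha n <= p / 64 * Num.sqrt (n%:R / (k n)%:R).
    by apply: le_trans hmin _; rewrite ler_pM2l // ge_min lexx.
  have h : alpha n ^+ 2 <= (p / 64) ^+ 2 * (n%:R / (k n)%:R).
    rewrite -(sqr_sqrtr (_ : 0 <= n%:R / (k n)%:R)) ?divr_ge0 // -exprMn.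
    by rewrite lerXn2r ?nnegrE ?mulr_ge0 ?sqrtr_ge0 ?(ltW e0) // ltW.
  have := ler_wpM2r (ltW kp) h.
  have -> : (p / 64) ^+ 2 * (n%:R / (k n)%:R) * (k n)%:R = p ^+ 2 * n%:R / (64 * 64).
    by field; rewrite gt_eqF.
  by lra.
apply: le_ereal_inf_tmp => _ [t [T [P [Pi [happ ->]]]]].
rewrite leNgt; apply/negP => hc.
have hcost (G : edge_set n) a w : simple_graph G ->
    ((\sum_(i < k n) size (transcript Pi G a w i))%N%:R%:E <= cost R Pi)%E.
  by move=> sG; apply: ereal_sup_ubound; exists G, a, w.
(* A cost below the bound is real or [-oo]; in the latter case [hcost] is contradictory for any
   transcript, and [s = 0] serves. *)
have [s [hs sc]] : exists s : R, (forall (G : edge_set n) a w, simple_graph G ->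
    (\sum_(i < k n) size (transcript Pi G a w i))%N%:R <= s) /\
    s < p ^+ 3 / (2 * (128 * 192)) * (n%:R * (k n)%:R / alpha n ^+ 2).
  move: hc hcost; case: (cost R Pi) => [s||] h hcost.
  - by exists s; split=> [G a w sG|]; rewrite -?lee_fin ?hcost // -lte_fin.
  - by move: h; rewrite ltNge leey.
  - exists 0; split=> [G a w /(hcost G a w)|]; first by rewrite leeNy_eq.
    by rewrite mulr_gt0 ?divr_gt0 ?exprn_gt0 ?mulr_gt0.
have := transcript_size_ge hp a1 hk hn hs happ.
by rewrite leNgt sc.
Unshelve. all: by end_near.
Qed.
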